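(* Let $\mathcal S_A$ be the set of all so-types over $A$, $\mathcal P_A$ the set of all so-pairs over $A$, and $\mathcal S_A(\mathfrak C)$ the set of all realizations of types in $\mathcal S_A$. Then: (i) $\not\perp^w$ is an equivalence relation on $\mathcal S_A$ and on $\mathcal P_A$; (ii) $\delta_A$ is an equivalence relation on $\mathcal P_A$; $\delta_A$ refines $\not\perp^w$ by splitting each class into two classes, each consisting of the reverses of pairs from the other class; (iii) $x\mathop{\not\downarrow}_A y$ is an equivalence relation on $\mathcal S_A(\mathfrak C)$; (iv) $\not\perp^f$ is an equivalence relation on $\mathcal S_A$.
   Context: $T$ complete (possibly multi-sorted), monster $\mathfrak C$, $A$ small. $a\mathop{\downarrow}_A B$: $\operatorname{tp}(a/AB)$ does not fork over $A$. For $p\in S(A)$ and a linear order $<_p$ on $p(\mathfrak C)$ that is the trace of an $A$-definable relation, $\mathbf p=(p,<_p)$ is an so-pair over $A$ if for every relatively definable (any parameters) $X\subseteq p(\mathfrak C)$ exactly one of $X$, $p(\mathfrak C)\setminus X$ contains a nonempty initial segment (is left-eventual) and exactly one contains a nonempty final segment (is right-eventual); $p$ is then an so-type. Its reverse is $\mathbf p^*=(p,>_p)$. $\mathbf p_r$ ($\mathbf p_l$) is the complete global type consisting of all formulas whose trace on $p(\mathfrak C)$ is right-eventual (left-eventual). For a small set $B$ and $a\models p$: $a$ is right (left) $\mathbf p$-generic over $B$ if $a$ realizes the restriction of $\mathbf p_r$ ($\mathbf p_l$) to $A\cup B$. $p\perp^w q$ means $p(x)\cup q(y)$ determines a complete type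 over $A$; $p\perp^f q$ means $a\mathop{\downarrow}_A b$ for all $a\models p,b\models q$; $\not\perp$ denotes negation; two so-pairs are $\not\perp^w$ if their types are. For so-pairs $\mathbf p=(p,<_p)$, $\mathbf q=(q,<_q)$ over $A$ with $p\not\perp^w q$, $\delta_A(\mathbf p,\mathbf q)$ (direct nonorthogonality) holds if for all $a\models p$, $b\models q$: ($a$ left $\mathbf p$-generic over $b$ $\Leftrightarrow$ $b$ right $\mathbf q$-generic over $a$) and ($a$ right $\mathbf p$-generic over $b$ $\Leftrightarrow$ $b$ left $\mathbf q$-generic over $a$).
   Formalization: So-types are required to be non-algebraic (p(C) infinite): a type with exactly one realization meets the quoted definition of an so-type, but it is weakly orthogonal to itself and its realization is independent of itself, so reflexivity would fail. *)

(* Defs.v *)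
From mathcomp Require Import all_boot.
From mathcomp Require Import boolp classical_sets functions cardinality.
Set Implicit Arguments.
Unset Strict Implicit.
Unset Printing Implicit Defensive.

Local Open Scope classical_set_scope.
Local Open Scope card_scope.

Record language := Language {
  sort : Type;
  func : Type;
  fdom : func -> seq sort;
  fcod : func -> sort;
  rel_sym : Type;
  rdom : rel_sym -> seq sort }.

Definition symbols (L : language) : Type := (sort L + func L + rel_sym L)%type.

(* A variable context is a type [V] of variables together with a sort for each
   of them.  Quantifiers are de Bruijn: the body of [All s phi] lives in the
   context [option V], where [None] is the bound variable. *)
Definition sort_of S (G : seq S) (i : 'I_(size G)) : S := tnth (in_tuple G) i.

Definition ext_sort S V (sg : V -> S) (s : S) (o : option V) : S :=
  if o is Some x then sg x else s.

Definition sum_sort S V W (sg : V -> S) (tau : W -> S) (z : V + W) : S :=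
  match z with inl x => sg x | inr y => tau y end.

Inductive term (L : language) (V : Type) (sg : V -> sort L) : sort L -> Type :=
| Var (x : V) : term sg (sg x)
| App (f : func L) :
    (forall i : 'I_(size (fdom f)), term sg (sort_of i)) -> term sg (fcod f).

Inductive formula (L : language) (V : Type) (sg : V -> sort L) : Type :=
| Bot
| Eq (s : sort L) of term sg s & term sg s
| Rel (r : rel_sym L) of
    (forall i : 'I_(size (rdom r)), term sg (sort_of i))
| Imp of formula sg & formula sg
| All (s : sort L) of formula (ext_sort sg s).

Definition Neg L V (sg : V -> sort L) (phi : formula sg) : formula sg :=
  Imp phi (Bot sg).

Record structure (L : language) := Structure {
  carrier :> sort L -> Type;
  carrier_inhabited : forall s, inhabited (carrier s);
  finterp : forall f : func L,
    (forall i : 'I_(size (fdom f)), carrier (sort_of i)) -> carrier (fcod f);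
  rinterp : forall r : rel_sym L,
    (forall i : 'I_(size (rdom r)), carrier (sort_of i)) -> Prop }.

(** [elt M] is the disjoint union of all the sorts of [M]. *)
Definition elt L (M : structure L) : Type := {s : sort L & M s}.

Definition val L (M : structure L) V (sg : V -> sort L) : Type :=
  forall x : V, M (sg x).

Definition tup L (M : structure L) (G : seq (sort L)) : Type :=
  val M (@sort_of _ G).

Definition coords L (M : structure L) (G : seq (sort L)) (a : tup M G) :
  set (elt M) := range (fun i => existT (fun s => M s) (sort_of i) (a i)).

Definition vext L (M : structure L) V (sg : V -> sort L) (v : val M sg) s
    (c : M s) : val M (ext_sort sg s) :=
  fun o => match o return M (ext_sort sg s o) with
           | Some x => v x | None => c end.

Definition vcat L (M : structure L) V W (sg : V -> sort L) (tau : W -> sort L)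
    (v : val M sg) (w : val M tau) : val M (sum_sort sg tau) :=
  fun z => match z return M (sum_sort sg tau z) with
           | inl x => v x | inr y => w y end.

Fixpoint eval L (M : structure L) V (sg : V -> sort L) (v : val M sg) s
    (t : term sg s) : M s :=
  match t with
  | Var x => v x
  | App f ts => finterp (fun i => eval v (ts i))
  end.

Fixpoint sat L (M : structure L) V (sg : V -> sort L) (phi : formula sg) :
    val M sg -> Prop :=
  match phi with
  | Bot => fun _ => False
  | Eq _ t u => fun v => eval v t = eval v u
  | Rel r ts => fun v => rinterp (fun i => eval v (ts i))
  | Imp phi psi => fun v => sat phi v -> sat psi v
  | All s phi => fun v => forall c : M s, sat phi (vext v c)
  end.

Definition sentence (L : language) := formula (@sort_of (sort L) [::]).

Definition holds L (M : structure L) (phi : sentence L) : Prop :=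
  forall v : tup M [::], sat phi v.

Definition model L (T : set (sentence L)) (M : structure L) : Prop :=
  forall phi, T phi -> holds M phi.

Definition complete_theory L (T : set (sentence L)) : Prop :=
  (exists M, model T M) /\
  forall phi : sentence L,
    (forall M, model T M -> holds M phi) \/
    (forall M, model T M -> holds M (Neg phi)).

(** A formula [phi(x, b)]: an [L]-formula [phi(x, y)] with a finite parameter
    tuple [b] of [M] substituted for [y]. *)
Record pformula L (M : structure L) V (sg : V -> sort L) := PFormula {
  par_sorts : seq (sort L);
  body : formula (sum_sort sg (@sort_of _ par_sorts));
  pars : tup M par_sorts }.
Arguments pars {L M V sg} p.

Definition psat L (M : structure L) V (sg : V -> sort L)
    (phi : pformula M sg) (a : val M sg) : Prop :=
  sat (body phi) (vcat a (pars phi)).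

Definition pneg L (M : structure L) V (sg : V -> sort L)
    (phi : pformula M sg) : pformula M sg :=
  PFormula (Neg (body phi)) (pars phi).

Definition over L (M : structure L) (B : set (elt M)) V (sg : V -> sort L) :
  set (pformula M sg) := [set phi | coords (pars phi) `<=` B].

Definition realizes L (M : structure L) V (sg : V -> sort L)
    (p : set (pformula M sg)) (a : val M sg) : Prop :=
  forall phi, p phi -> psat phi a.

Definition locus L (M : structure L) V (sg : V -> sort L)
    (p : set (pformula M sg)) : set (val M sg) := [set a | realizes p a].

Definition tp L (M : structure L) V (sg : V -> sort L) (a : val M sg)
    (B : set (elt M)) : set (pformula M sg) :=
  [set phi | over B phi /\ psat phi a].

Definition finitely_satisfiable L (M : structure L) V (sg : V -> sort L)
    (p : set (pformula M sg)) : Prop :=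
  forall p0, finite_set p0 -> p0 `<=` p -> exists a, realizes p0 a.

Definition complete_type L (M : structure L) (B : set (elt M)) V
    (sg : V -> sort L) (p : set (pformula M sg)) : Prop :=
  [/\ p `<=` @over L M B V sg, finitely_satisfiable p
    & forall phi, over B phi -> p phi \/ p (pneg phi)].

(** A cardinal is represented by a type [kappa] of that cardinality. *)
Definition small (kappa : Type) X (B : set X) : Prop :=
  ~ ([set: kappa] #<= B).

Definition saturated (kappa : Type) L (M : structure L) : Prop :=
  forall (B : set (elt M)), small kappa B ->
  forall (G : seq (sort L)) (p : set (pformula M (@sort_of _ G))),
    complete_type B p -> exists a, realizes p a.

Definition automorphism L (M : structure L) (g : forall s, M s -> M s) : Prop :=
  [/\ forall s, bijective (g s),
      forall f a, g (fcod f) (finterp a) = finterp (fun i => g (sort_of i) (a i))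
    & forall r (a : tup M (rdom r)),
        rinterp a <-> rinterp (fun i => g (sort_of i) (a i))].

(* Only the values of [h] on [B] matter. *)
Definition elementary_on L (M : structure L) (B : set (elt M))
    (h : forall s, M s -> M s) : Prop :=
  forall (G : seq (sort L)) (phi : formula (@sort_of _ G)) (b : tup M G),
    coords b `<=` B -> (sat phi b <-> sat phi (fun i => h _ (b i))).

Definition strongly_homogeneous (kappa : Type) L (M : structure L) : Prop :=
  forall (B : set (elt M)) (h : forall s, M s -> M s),
    small kappa B -> elementary_on B h ->
    exists2 g, automorphism g &
      forall s (c : M s), B (existT (fun s => M s) s c) -> g s c = h s c.

Definition monster (kappa : Type) L (T : set (sentence L)) (C : structure L) :
    Prop :=
  [/\ small kappa [set: nat] /\ small kappa [set: symbols L],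
      model T C, saturated kappa C & strongly_homogeneous kappa C].

(** [phi(x, b)] divides over [A]: for some [k] and some sequence [(b_i)] of
    realizations of [tp(b/A)], the set [{phi(x, b_i)}] is [k]-inconsistent. *)
Definition divides L (M : structure L) (A : set (elt M)) V (sg : V -> sort L)
    (phi : pformula M sg) : Prop :=
  exists (k : nat) (b : nat -> tup M (par_sorts phi)),
    (forall i, realizes (tp (pars phi) A) (b i)) /\
    forall I : seq nat, uniq I -> size I = k ->
      ~ exists a, forall i, i \in I -> psat (PFormula (body phi) (b i)) a.

(** [p] forks over [A] if it implies a finite disjunction of formulas dividing
    over [A]; compactness is built into the implication. *)
Definition forks L (M : structure L) (A : set (elt M)) V (sg : V -> sort L)
    (p : set (pformula M sg)) : Prop :=
  exists (n : nat) (phi : 'I_n -> pformula M sg) (p0 : set (pformula M sg)),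
    [/\ forall l, divides A (phi l), finite_set p0, p0 `<=` p
      & forall a, realizes p0 a -> exists l, psat (phi l) a].

Definition indep L (M : structure L) (A : set (elt M)) (G : seq (sort L))
    (a : tup M G) (B : set (elt M)) : Prop :=
  ~ forks A (tp a (A `|` B)).

Definition ftuple L (M : structure L) : Type := {G : seq (sort L) & tup M G}.

Definition ftype L (M : structure L) : Type :=
  {G : seq (sort L) & set (pformula M (@sort_of _ G))}.

Definition forks_with L (M : structure L) (A : set (elt M))
    (x y : ftuple M) : Prop :=
  ~ indep A (projT2 x) (coords (projT2 y)).

(** [p(x)] and [q(y)] together decide every formula [phi(x, y)] over [A]; as [A] is small,
    entailment by [p(x)] and [q(y)] is tested on realizations in the monster. *)
Definition weakly_orthogonal L (M : structure L) (A : set (elt M)) (p q : ftype M) : Prop :=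
  forall phi : pformula M (sum_sort (@sort_of _ (projT1 p))
                                    (@sort_of _ (projT1 q))),
    over A phi ->
    (forall a b, realizes (projT2 p) a -> realizes (projT2 q) b ->
       psat phi (vcat a b)) \/
    (forall a b, realizes (projT2 p) a -> realizes (projT2 q) b ->
       psat (pneg phi) (vcat a b)).

Definition fork_orthogonal L (M : structure L) (A : set (elt M)) (p q : ftype M) : Prop :=
  forall a b, realizes (projT2 p) a -> realizes (projT2 q) b ->
    indep A a (coords b).

Definition not_weakly_orthogonal L (M : structure L) (A : set (elt M)) (p q : ftype M) : Prop :=
  ~ weakly_orthogonal A p q.

Definition not_fork_orthogonal L (M : structure L) (A : set (elt M)) (p q : ftype M) : Prop :=
  ~ fork_orthogonal A p q.

Definition linear_order X (D : set X) (lt : X -> X -> Prop) : Prop :=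
  [/\ forall a, D a -> ~ lt a a,
      forall a b c, D a -> D b -> D c -> lt a b -> lt b c -> lt a c
    & forall a b, D a -> D b -> [\/ lt a b, a = b | lt b a]].

Definition initial_segment X (D : set X) (lt : X -> X -> Prop) (I : set X) :
    Prop :=
  I `<=` D /\ forall a b, I a -> D b -> lt b a -> I b.

Definition final_segment X (D : set X) (lt : X -> X -> Prop) (I : set X) :
    Prop :=
  I `<=` D /\ forall a b, I a -> D b -> lt a b -> I b.

Definition left_eventual X (D : set X) (lt : X -> X -> Prop) (Y : set X) :
    Prop :=
  exists I, [/\ initial_segment D lt I, I !=set0 & I `<=` Y].

Definition right_eventual X (D : set X) (lt : X -> X -> Prop) (Y : set X) :
    Prop :=
  exists I, [/\ final_segment D lt I, I !=set0 & I `<=` Y].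

Definition exactly_one (P Q : Prop) : Prop := (P /\ ~ Q) \/ (~ P /\ Q).

Record opair L (M : structure L) := OPair {
  vars : seq (sort L);
  type_of : set (pformula M (@sort_of _ vars));
  lt_of : tup M vars -> tup M vars -> Prop }.
Arguments type_of {L M} o.
Arguments lt_of {L M} o.

Definition ftype_of L (M : structure L) (P : opair M) : ftype M :=
  existT (fun G => set (pformula M (@sort_of _ G))) (vars P) (type_of P).

Definition reverse L (M : structure L) (P : opair M) : opair M :=
  OPair (type_of P) (fun a b => lt_of P b a).

Definition trace L (M : structure L) V (sg : V -> sort L)
    (p : set (pformula M sg)) (phi : pformula M sg) : set (val M sg) :=
  [set a | locus p a /\ psat phi a].

(* Types with a single realization are excluded: their one-point order would
   satisfy the remaining clauses, but such a type is weakly orthogonal to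
   itself. *)
Definition so_pair L (M : structure L) (A : set (elt M)) (P : opair M) : Prop :=
  let p := type_of P in
  [/\ complete_type A p,
      infinite_set (locus p),
      [/\ linear_order (locus p) (lt_of P),
          forall a b, lt_of P a b -> locus p a /\ locus p b
        & exists2 phi : pformula M (sum_sort (@sort_of _ (vars P))
                                             (@sort_of _ (vars P))),
            over A phi &
            forall a b, locus p a -> locus p b ->
              (lt_of P a b <-> psat phi (vcat a b))]
    & forall phi : pformula M (@sort_of _ (vars P)),
        let X := trace p phi in
        exactly_one (left_eventual (locus p) (lt_of P) X)
                    (left_eventual (locus p) (lt_of P) (locus p `\` X)) /\
        exactly_one (right_eventual (locus p) (lt_of P) X)
                    (right_eventual (locus p) (lt_of P) (locus p `\` X))].

Definition so_pairs L (M : structure L) (A : set (elt M)) : set (opair M) :=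
  [set P | so_pair A P].

Definition so_types L (M : structure L) (A : set (elt M)) : set (ftype M) :=
  [set ftype_of P | P in so_pairs A].

Definition so_realizations L (M : structure L) (A : set (elt M)) :
  set (ftuple M) :=
  [set x | exists2 p, so_types A p &
     exists2 a, realizes (projT2 p) a & x = existT (tup M) (projT1 p) a].

Definition left_type L (M : structure L) (P : opair M) :
  set (pformula M (@sort_of _ (vars P))) :=
  [set phi | left_eventual (locus (type_of P)) (lt_of P)
                     (trace (type_of P) phi)].
Arguments left_type {L M} P.

Definition right_type L (M : structure L) (P : opair M) :
  set (pformula M (@sort_of _ (vars P))) :=
  [set phi | right_eventual (locus (type_of P)) (lt_of P)
                      (trace (type_of P) phi)].
Arguments right_type {L M} P.

Definition left_generic L (M : structure L) (A : set (elt M)) (P : opair M)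
    (a : tup M (vars P)) (B : set (elt M)) : Prop :=
  realizes (left_type P `&` @over L M (A `|` B) _ _) a.
Arguments left_generic {L M} A P a B.

Definition right_generic L (M : structure L) (A : set (elt M)) (P : opair M)
    (a : tup M (vars P)) (B : set (elt M)) : Prop :=
  realizes (right_type P `&` @over L M (A `|` B) _ _) a.
Arguments right_generic {L M} A P a B.

Definition pairs_not_weakly_orthogonal L (M : structure L) (A : set (elt M)) (P Q : opair M) :
    Prop := not_weakly_orthogonal A (ftype_of P) (ftype_of Q).

Definition delta L (M : structure L) (A : set (elt M)) (P Q : opair M) : Prop :=
  pairs_not_weakly_orthogonal A P Q /\
  forall a b, realizes (type_of P) a -> realizes (type_of Q) b ->
    (left_generic A P a (coords b) <-> right_generic A Q b (coords a)) /\
    (right_generic A P a (coords b) <-> left_generic A Q b (coords a)).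

Definition equivalence_on X (S : set X) (R : X -> X -> Prop) : Prop :=
  [/\ forall x, S x -> R x x,
      forall x y, S x -> S y -> R x y -> R y x
    & forall x y z, S x -> S y -> S z -> R x y -> R y z -> R x z].

Definition class_of X (S : set X) (R : X -> X -> Prop) (x : X) : set X :=
  [set y | S y /\ R x y].

Definition classes X (S : set X) (R : X -> X -> Prop) : set (set X) :=
  [set class_of S R x | x in S].

(* Main.v *)
From mathcomp Require Import all_boot.
From mathcomp Require Import boolp classical_sets functions cardinality.
Require Import Defs.
(** Everything is read off from automorphisms and saturation. For so-pairs P, Q
    and b realizing q, the left generics over b form an initial segment of
    p(C) which is a single orbit over Ab, and likewise on the right. Either
    some left P-generic a over b has b generic over a on a definite side, and
    then by homogeneity all such pairs behave alike, or b lies in a bounded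
    definable piece of q(C), which is impossible. So non-orthogonal pairs
    satisfy exactly one of delta(P, Q) and delta(P, reverse Q). In the first case the
    segment of left P-generics over b grows with b; this monotonicity
    yields transitivity of delta. Finally a forks with b over A exactly when a
    is neither left nor right generic over b: generic types extend to
    invariant ones, while a bounded definable set can be moved off itself. *)

Set Implicit Arguments.
Unset Strict Implicit.
Unset Printing Implicit Defensive.
Local Open Scope classical_set_scope.
Local Open Scope card_scope.

(** * Substitution, definable sets and automorphisms *)

(** The arguments are about sets rather than formulas: [definable B X] hides contexts and parameter
    tuples, and generics are only taken over finite extensions of A, so smallness is never lost.
    Transitivity needs more than monotonicity: if delta(P, Q) and delta(Q, R) hold and c is right
    R-generic over a, there is an intermediate b, with a left generic over b and b left generic over
    c. If delta(P, R) failed, comparing such a b with a right Q-generic b0 over c would make a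
    suitable a both left and right generic over b0. The same interpolation gives transitivity of
    forking. The obstacle for forking is that dividing tests all tuples of the given sorts, whereas
    the order is controlled on p(C) only; compactness supplies A-definable sets around p(C) on which
    the needed consequences persist. *)

Fixpoint tsubst L V W (sg : V -> sort L) (tau : W -> sort L)
    (r : forall x, term tau (sg x)) s (t : term sg s) : term tau s :=
  match t with
  | Var x => r x
  | App f ts => App (fun i => tsubst r (ts i))
  end.

Definition lift_subst L V W (sg : V -> sort L) (tau : W -> sort L)
    (r : forall x, term tau (sg x)) s (o : option V) :
    term (ext_sort tau s) (ext_sort sg s o) :=
  match o return term (ext_sort tau s) (ext_sort sg s o) with
  | Some x => tsubst (fun y => Var (ext_sort tau s) (Some y)) (r x)
  | None => Var (ext_sort tau s) None
  end.

Fixpoint fsubst L V (sg : V -> sort L) (phi : formula sg) :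
    forall W (tau : W -> sort L), (forall x, term tau (sg x)) -> formula tau :=
  match phi with
  | Bot => fun W tau _ => Bot tau
  | Eq _ t u => fun W tau r => Eq (tsubst r t) (tsubst r u)
  | Rel R ts => fun W tau r => Rel (fun i => tsubst r (ts i))
  | Imp phi psi => fun W tau r => Imp (fsubst phi r) (fsubst psi r)
  | All s phi => fun W tau r => All (fsubst phi (lift_subst r s))
  end.

Lemma eval_subst L (M : structure L) V W (sg : V -> sort L) (tau : W -> sort L)
    (r : forall x, term tau (sg x)) (v : val M tau) s (t : term sg s) :
  eval v (tsubst r t) = eval (fun x => eval v (r x)) t.
Proof.
elim: t => [x|f ts IH] //=; congr finterp.
by apply: functional_extensionality_dep => i; exact: IH.
Qed.

Lemma sat_subst L (M : structure L) V (sg : V -> sort L) (phi : formula sg) :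
  forall W (tau : W -> sort L) (r : forall x, term tau (sg x)) (v : val M tau),
  sat (fsubst phi r) v <-> sat phi (fun x => eval v (r x)).
Proof.
elim: phi => {V sg} [V sg|V sg s t u|V sg R ts|V sg phi IH1 psi IH2|V sg s phi IH]
  W tau r v //=.
- by rewrite !eval_subst.
- suff -> : (fun i => eval v (tsubst r (ts i))) =
           (fun i => eval (fun x => eval v (r x)) (ts i)) by [].
  by apply: functional_extensionality_dep => i; exact: eval_subst.
- by rewrite IH1 IH2.
- have E c : (fun x => eval (vext v c) (lift_subst r s x)) =
             vext (fun x => eval v (r x)) c.
    apply: functional_extensionality_dep => -[x|] //=.
    by rewrite eval_subst; congr eval; apply: functional_extensionality_dep.
  by split=> H c; [rewrite -E; apply/IH|apply/IH; rewrite E].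
Qed.

(** Coordinates whose sorts are only provably equal are compared inside the disjoint union [elt M],
    which avoids transports. *)
Definition mk L (M : structure L) (s : sort L) (c : M s) : elt M :=
  existT (fun s => M s) s c.

Lemma mk_inj L (M : structure L) (s : sort L) : injective (@mk L M s).
Proof.
move=> c c' e; have /= := projT2_eq e.
by rewrite (Prop_irrelevance (projT1_eq e) erefl).
Qed.

Lemma mk_cast L (M : structure L) (s s' : sort L) (c : M s) :
  s = s' -> exists c' : M s', mk c' = mk c.
Proof. by move=> e; case: s' / e; exists c. Qed.

Lemma var_term L (M : structure L) V (sg : V -> sort L) (x : V) s :
  sg x = s -> exists t : term sg s, forall v : val M sg, mk (v x) = mk (eval v t).
Proof. by move=> e; case: s / e; exists (Var sg x). Qed.

Lemma val_inhabited L (M : structure L) V (sg : V -> sort L) :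
  inhabited (val M sg).
Proof.
have H x : exists c : M (sg x), True by case: (carrier_inhabited M (sg x)) => c; exists c.
by constructor; move=> x; exact: (projT1 (cid (H x))).
Qed.

(** A [pformula] takes its parameters as a tuple indexed by ordinals; enumerating [W] brings any
    finite sorted family into this shape. *)
Lemma finite_pars L (M : structure L) (B : set (elt M)) (W : finType)
    (tau : W -> sort L) (w : val M tau) :
  (forall y, B (mk (w y))) ->
  exists G (b : tup M G), coords b `<=` B /\
    forall y, exists i, mk (b i) = mk (w y).
Proof.
move=> Bw; pose G := [seq tau y | y <- enum W].
have eG : size G = #|W| by rewrite size_map -cardE.
pose ev (i : 'I_(size G)) : W := enum_val (cast_ord eG i).
have sE i : tau (ev i) = sort_of i.
  rewrite /sort_of (tnth_nth (tau (ev i))) /= (nth_map (ev i)).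
    by congr tau; rewrite {1}/ev (enum_val_nth (ev i)).
  by rewrite -cardE -eG.
have H i : exists c : M (sort_of i), mk c = mk (w (ev i)) by exact: mk_cast.
pose b : tup M G := fun i => projT1 (cid (H i)).
have bE i : mk (b i) = mk (w (ev i)) by exact: (projT2 (cid (H i))).
exists G, b; split.
  by move=> _ [i _ <-]; move: (bE i); rewrite /mk => ->; exact: Bw.
move=> y; exists (cast_ord (esym eG) (enum_rank y)).
by rewrite bE /ev cast_ordKV enum_rankK.
Qed.

(** Renaming variables and plugging in parameters from [B] are the only substitutions of points that
    occur; definability over [B] pulls back along them. *)
Definition simple_map L (M : structure L) (B : set (elt M)) V W
    (sg : V -> sort L) (tau : W -> sort L) (F : val M sg -> val M tau) : Prop :=
  forall y, (exists x, forall v, mk (v x) = mk (F v y)) \/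
            (exists2 c, B (mk c) & forall v, F v y = c).

Definition definable L (M : structure L) (B : set (elt M)) V (sg : V -> sort L)
    (X : set (val M sg)) : Prop :=
  exists2 phi : pformula M sg, over B phi & forall v, psat phi v <-> X v.

(** The coordinates where [F] is a constant from [B] become the parameter tuple, the others become
    variables; an arbitrary point [v0] reads off the constants. *)
Lemma definable_formula L (M : structure L) (B : set (elt M)) V (W : finType)
    (sg : V -> sort L) (tau : W -> sort L) (phi : formula tau)
    (F : val M sg -> val M tau) :
  simple_map B F -> definable B [set v | sat phi (F v)].
Proof.
move=> sF; have [v0] := val_inhabited M sg.
pose isc y := `[< exists2 c, B (mk c) & forall v, F v y = c >].
pose W0 : finType := {y | isc y}.
have Bw (y : W0) : B (mk (F v0 (projT1 y))).
  by case: (y) => z /= /asboolP[c Bc] ->.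
have [G [b [bB bE]]] := @finite_pars _ _ B W0 _ (fun y : W0 => F v0 (projT1 y)) Bw.
have H y : exists t : term (sum_sort sg (@sort_of _ G)) (tau y),
    forall v, eval (vcat v b) t = F v y.
  case: (boolP (isc y)) => [iy|/asboolPn niy].
    have [i bi] := bE (exist _ y iy).
    have [t tE] := @var_term _ M _ (sum_sort sg (@sort_of _ G)) (inr i) (tau y)
      (projT1_eq bi).
    exists t => v; apply: mk_inj; rewrite -tE /= bi /=; congr mk.
    by have /asboolP[c _ cE] := iy; rewrite !cE.
  have [[x xE]|//] := sF y.
  have [t tE] := @var_term _ M _ (sum_sort sg (@sort_of _ G)) (inl x) (tau y)
      (projT1_eq (xE v0)).
  by exists t => v; apply: mk_inj; rewrite -tE /= xE.
pose r y := projT1 (cid (H y)).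
exists (PFormula (fsubst phi r) b) => [//|v].
rewrite /psat /= sat_subst.
suff -> : (fun x => eval (vcat v b) (r x)) = F v by [].
by apply: functional_extensionality_dep => y; exact: (projT2 (cid (H y))).
Qed.

Lemma definable_preim L (M : structure L) (B : set (elt M)) V (W : finType)
    (sg : V -> sort L) (tau : W -> sort L) (X : set (val M tau))
    (F : val M sg -> val M tau) :
  simple_map B F -> definable B X -> definable B [set v | X (F v)].
Proof.
move=> sF [phi oB pX].
have /(definable_formula (body phi)) [psi oB' pE] :
    simple_map B (fun v => vcat (F v) (pars phi)).
  case=> [y|i] /=.
    by have [[x xE]|[c Bc cE]] := sF y; [left; exists x|right; exists c].
  by right; exists (pars phi i) => //; apply: oB; exists i.
by exists psi => // v; rewrite pE /= -pX.
Qed.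

Lemma definable_sub L (M : structure L) (B B' : set (elt M)) V
    (sg : V -> sort L) (X : set (val M sg)) :
  B `<=` B' -> definable B X -> definable B' X.
Proof. by move=> BB' [phi o e]; exists phi => // x /o /BB'. Qed.

Lemma definable_ext L (M : structure L) (B : set (elt M)) V
    (sg : V -> sort L) (X Y : set (val M sg)) :
  (forall v, X v <-> Y v) -> definable B X -> definable B Y.
Proof. by move=> XY [phi o e]; exists phi => // v; rewrite e. Qed.

Lemma definable_not L (M : structure L) (B : set (elt M)) V
    (sg : V -> sort L) (X : set (val M sg)) :
  definable B X -> definable B [set v | ~ X v].
Proof. by move=> [phi o e]; exists (pneg phi) => // v; rewrite /= -e. Qed.

(** The two formulas carry different parameter tuples. Both are moved to a context with the two
    index types side by side, which [definable_formula] folds back into one tuple. *)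
Lemma definable_imp L (M : structure L) (B : set (elt M)) (V : finType)
    (sg : V -> sort L) (X Y : set (val M sg)) :
  definable B X -> definable B Y -> definable B [set v | X v -> Y v].
Proof.
move=> [phi o1 e1] [psi o2 e2].
pose tau := sum_sort sg (sum_sort (@sort_of _ (par_sorts phi))
                                  (@sort_of _ (par_sorts psi))).
pose r1 (z : V + 'I_(size (par_sorts phi))) :
    term tau (sum_sort sg (@sort_of _ (par_sorts phi)) z) :=
  match z return term tau (sum_sort sg (@sort_of _ (par_sorts phi)) z) with
  | inl x => Var tau (inl x) | inr i => Var tau (inr (inl i)) end.
pose r2 (z : V + 'I_(size (par_sorts psi))) :
    term tau (sum_sort sg (@sort_of _ (par_sorts psi)) z) :=
  match z return term tau (sum_sort sg (@sort_of _ (par_sorts psi)) z) with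
  | inl x => Var tau (inl x) | inr i => Var tau (inr (inr i)) end.
have /(definable_formula (Imp (fsubst (body phi) r1) (fsubst (body psi) r2))) :
    simple_map B (fun v : val M sg => vcat v (vcat (pars phi) (pars psi))).
  case=> [y|[i|i]] /=; first by left; exists y.
  - by right; exists (pars phi i) => //; apply: o1; exists i.
  - by right; exists (pars psi i) => //; apply: o2; exists i.
apply: definable_ext => v /=; rewrite !sat_subst -e1 -e2 /psat.
have -> : (fun x => eval (vcat v (vcat (pars phi) (pars psi))) (r1 x)) =
          vcat v (pars phi) by apply: functional_extensionality_dep; case.
have -> // : (fun x => eval (vcat v (vcat (pars phi) (pars psi))) (r2 x)) =
          vcat v (pars psi) by apply: functional_extensionality_dep; case.
Qed.

Lemma definable_and L (M : structure L) (B : set (elt M)) (V : finType)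
    (sg : V -> sort L) (X Y : set (val M sg)) :
  definable B X -> definable B Y -> definable B [set v | X v /\ Y v].
Proof.
move=> dX dY; have := definable_not (definable_imp dX (definable_not dY)).
apply: definable_ext => v /=; split; last by move=> [x y] /(_ x); apply.
by move=> /not_implyP[Xv /contrapT Yv].
Qed.

Lemma definable_true L (M : structure L) (B : set (elt M)) V
    (sg : V -> sort L) : definable B [set v : val M sg | True].
Proof.
have [v0] := val_inhabited M (@sort_of (sort L) [::]).
exists (PFormula (Imp (Bot (sum_sort sg (@sort_of _ [::]))) (Bot _)) v0).
  by move=> _ [i _ <-]; case: i.
by move=> v; split=> // _ [].
Qed.

Definition app L (M : structure L) (g : forall s, M s -> M s) V
    (sg : V -> sort L) (v : val M sg) : val M sg := fun x => g (sg x) (v x).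

Lemma eval_aut L (M : structure L) (g : forall s, M s -> M s) V
    (sg : V -> sort L) (v : val M sg) s (t : term sg s) :
  automorphism g -> g s (eval v t) = eval (app g v) t.
Proof.
move=> [_ gf _]; elim: t => [//|f ts IH] /=; rewrite gf; congr finterp.
by apply: functional_extensionality_dep => i; exact: IH.
Qed.

Lemma sat_aut L (M : structure L) (g : forall s, M s -> M s) V
    (sg : V -> sort L) (phi : formula sg) : automorphism g ->
  forall v : val M sg, sat phi (app g v) <-> sat phi v.
Proof.
move=> gA; case: (gA) => gb gf gr.
elim: phi => {V sg} [V sg|V sg s t u|V sg R ts|V sg phi IH1 psi IH2|V sg s phi IH]
  v //=.
- rewrite -!eval_aut //; split=> [|-> //]; exact: (bij_inj (gb s)).
- rewrite [X in _ <-> X]gr.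
  suff -> : (fun i => eval (app g v) (ts i)) =
           (fun i => g (sort_of i) (eval v (ts i))) by [].
  by apply: functional_extensionality_dep => i; rewrite eval_aut.
- by rewrite IH1 IH2.
- have E c : app g (vext v c) = vext (app g v) (g s c).
    by apply: functional_extensionality_dep => -[].
  split=> H c; first by apply/IH; rewrite E.
  by have [h _ hK] := gb s; rewrite -[c]hK -E; apply/IH.
Qed.

Lemma psat_aut L (M : structure L) (g : forall s, M s -> M s) V
    (sg : V -> sort L) (phi : pformula M sg) (v : val M sg) : automorphism g ->
  psat (PFormula (body phi) (app g (pars phi))) (app g v) <-> psat phi v.
Proof.
move=> gA; rewrite /psat -(sat_aut (body phi) gA) /=.
suff -> : vcat (app g v) (app g (pars phi)) = app g (vcat v (pars phi)) by [].
by apply: functional_extensionality_dep; case.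
Qed.

(** The inverse is part of the data because images under [g] are written as preimages under [h]. *)
Definition aut L (M : structure L) (B : set (elt M))
    (g h : forall s, M s -> M s) : Prop :=
  [/\ automorphism g, automorphism h,
      forall s, cancel (g s) (h s), forall s, cancel (h s) (g s)
    & forall s (c : M s), B (mk c) -> g s c = c].

Lemma automorphism_inv L (M : structure L) (g : forall s, M s -> M s) :
  automorphism g -> exists h, [/\ automorphism h,
      forall s, cancel (g s) (h s) & forall s, cancel (h s) (g s)].
Proof.
move=> [gb gf gr].
have H s : exists h, cancel (g s) h /\ cancel h (g s).
  by have [h hK Kh] := gb s; exists h.
pose h s := projT1 (cid (H s)).
have gK s : cancel (g s) (h s) by case: (projT2 (cid (H s))).
have hK s : cancel (h s) (g s) by case: (projT2 (cid (H s))).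
exists h; split => //; split.
- by move=> s; exists (g s).
- move=> f a; apply: (can_inj (gK _)); rewrite hK gf; congr finterp.
  by apply: functional_extensionality_dep => i; rewrite hK.
- move=> r a; rewrite [X in _ <-> X]gr.
  suff {1}-> : a = (fun i => g (sort_of i) (h (sort_of i) (a i))) by [].
  by apply: functional_extensionality_dep => i; rewrite hK.
Qed.

Lemma aut_inv L (M : structure L) (B : set (elt M)) g h :
  @aut L M B g h -> aut B h g.
Proof.
move=> [ga ha gK hK gB]; split=> // s c Bc.
by rewrite -[in LHS](gB _ _ Bc) gK.
Qed.

Lemma aut_sub L (M : structure L) (B B' : set (elt M)) g h :
  B' `<=` B -> @aut L M B g h -> aut B' g h.
Proof. by move=> s [ga ha gK hK gB]; split=> // t c /s; exact: gB. Qed.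

Lemma automorphism_comp L (M : structure L) (g g' : forall s, M s -> M s) :
  automorphism g -> automorphism g' -> automorphism (fun s c => g s (g' s c)).
Proof.
move=> [gb gf gr] [gb' gf' gr']; split.
- by move=> s; exact: (bij_comp (gb s) (gb' s)).
- by move=> f a; rewrite gf' gf.
- by move=> r a; rewrite gr' gr.
Qed.

Lemma aut_comp L (M : structure L) (B : set (elt M)) g h g' h' :
  @aut L M B g h -> aut B g' h' ->
  aut B (fun s c => g s (g' s c)) (fun s c => h' s (h s c)).
Proof.
move=> [ga ha gK hK gB] [ga' ha' gK' hK' gB']; split.
- exact: automorphism_comp.
- exact: automorphism_comp.
- by move=> s c; rewrite gK gK'.
- by move=> s c; rewrite hK' hK.
- by move=> s c Bc; rewrite gB' // gB.
Qed.

Lemma appK L (M : structure L) (B : set (elt M)) g h V (sg : V -> sort L)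
    (v : val M sg) : aut B g h -> app h (app g v) = v.
Proof.
by move=> [_ _ gK _ _]; apply: functional_extensionality_dep => x; exact: gK.
Qed.

Lemma app_fix L (M : structure L) (B : set (elt M)) g h G (v : tup M G) :
  aut B g h -> coords v `<=` B -> app g v = v.
Proof.
move=> [_ _ _ _ gB] vB; apply: functional_extensionality_dep => x.
by apply: gB; apply: vB; exists x.
Qed.

Lemma definable_aut L (M : structure L) (B : set (elt M)) g h V
    (sg : V -> sort L) (X : set (val M sg)) v :
  aut B g h -> definable B X -> (X (app g v) <-> X v).
Proof.
move=> gA [phi o e]; have [ga _ _ _ _] := gA; rewrite -!e -(psat_aut phi v ga).
by rewrite /psat (app_fix gA o).
Qed.

(** * Compactness and homogeneity *)

(** Hilbert's hotel: a sequence [e] inside [B] is sent onto itself by its even terms, which frees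
    the odd terms to enumerate [F]. *)
Lemma infinite_setU_le T (B F : set T) :
  infinite_set B -> countable F -> B `|` F #<= B.
Proof.
elim/Ppointed: T => T in B F *; first by rewrite !emptyE => /(_ (finite_set0 _)).
move=> /infiniteP/pcard_leP/injfunPex[e eB /in2TT einj] /pfcard_geP[->|[u]].
  by rewrite setU0 card_lexx.
pose s z := if pselect (exists n, e n = z) is left h
  then let n := projT1 (cid h) in if odd n then u n./2 else e n./2 else z.
have sE n : s (e n) = if odd n then u n./2 else e n./2.
  rewrite /s; case: pselect => [h|[]]; last by exists n.
  by have /einj -> := projT2 (cid h).
apply: card_le_trans (card_image_le s _); apply: subset_card_le => z [Bz|Fz].
  have [[n <-]|nz] := pselect (exists n, e n = z).
    by exists (e n.*2); [exact: eB|rewrite sE odd_double doubleK].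
  by exists z => //; rewrite /s; case: pselect.
have [n _ <-] := @surj _ _ _ _ u _ Fz.
by exists (e n.*2.+1); [exact: eB|rewrite sE /= odd_double uphalf_double].
Qed.

Lemma small_setU kappa T (B F : set T) : small kappa [set: nat] ->
  small kappa B -> finite_set F -> small kappa (B `|` F).
Proof.
move=> sn sB fF; have [fB|iB] := pselect (finite_set B).
  move=> h; apply: sn; apply: card_le_trans h _.
  by apply: finite_set_countable; rewrite finite_setU.
move=> h; apply: sB; apply: card_le_trans h _.
by apply: infinite_setU_le => //; exact: finite_set_countable.
Qed.

Lemma finite_set_induct T (Q : set T -> Prop) : Q set0 ->
  (forall x D, Q D -> Q (x |` D)) -> forall D, finite_set D -> Q D.
Proof.
move=> Q0 QS D /finite_set_leP[n] /pfcard_geP[->//|[f]].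
have -> : D = f @` `I_n by rewrite image_eq.
elim: n {f} (f : nat -> T) => [|n IH] f; first by rewrite II0 image_set0.
have -> : f @` `I_n.+1 = f n |` f @` `I_n by rewrite IISl image_setU image_set1.
exact/QS/IH.
Qed.

Lemma finite_coords L (M : structure L) G (b : tup M G) : finite_set (coords b).
Proof. by apply: finite_image; exact: finite_finset. Qed.

Lemma definable_realizes L (M : structure L) (A : set (elt M)) (V : finType)
    (sg : V -> sort L) (p : set (pformula M sg)) :
  finite_set p -> p `<=` @over L M A V sg -> definable A (locus p).
Proof.
move: p; apply: finite_set_induct => [_|phi p IH oA].
  by apply: definable_ext (definable_true A sg) => v; split=> // _ phi [].
have oP : over A phi by apply: oA; left.
have := definable_and (ex_intro2 _ _ phi oP (fun v => iff_refl _))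
  (IH (fun x px => oA x (or_intror px))).
apply: definable_ext => v; split=> [[h1 h2] psi [->//|/h2//]|h].
by split=> [|psi ppsi]; apply: h; [left|right].
Qed.

(** Saturation speaks of complete types only, so Zorn provides a maximal finitely satisfiable
    extension. The chain condition is put on [p] joined with X, not on supersets of [p], so that it
    also covers the empty chain. *)
Lemma realize_partial L kappa (C : structure L) (B : set (elt C)) G
    (p : set (pformula C (@sort_of _ G))) :
  saturated kappa C -> small kappa B -> p `<=` @over L C B _ _ ->
  finitely_satisfiable p -> exists a, realizes p a.
Proof.
move=> sC sB oB fs.
pose Q (X : set (pformula C (@sort_of _ G))) :=
  X `<=` @over L C B _ _ /\ finitely_satisfiable (p `|` X).
have [F FQ tF|X [[oX fX] Xmax]] := @Zorn_bigcup _ Q.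
  split=> [phi [X FX Xphi]|]; first by case: (FQ _ FX) => + _; apply.
  have H p0 : finite_set p0 -> p0 `<=` p `|` \bigcup_(X in F) X ->
      p0 `<=` p \/ exists2 X, F X & p0 `<=` p `|` X.
    move: p0; apply: finite_set_induct => [_|phi p0 IH p0X]; first by left.
    have {IH} := IH (fun x px => p0X x (or_intror px)).
    have := p0X phi (or_introl erefl).
    case=> [pphi|[Y FY Yphi]] [pp|[X FX pX]].
    - by left=> psi [->//|/pp].
    - by right; exists X => // psi [->|/pX//]; left.
    - by right; exists Y => // psi [->|/pp]; [right|left].
    - have [XY|YX] := tF _ _ FX FY.
        by right; exists Y => // psi [->|/pX[|/XY]]; [right|left|right].
      by right; exists X => // psi [->|/pX//]; right; exact: YX.
  move=> p0 fp0 /(H _ fp0)[|[X FX]]; first exact: fs.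
  by case: (FQ _ FX) => _; apply.
have [] := sC _ sB _ (p `|` X).
  split=> // [phi [/oB//|/oX//]|phi ophi].
  apply: contrapT => /not_orP[n1 n2].
  (* By maximality a formula left out is refuted by a finite part; if both [phi] and its negation
     were left out, the union of the two finite parts would be unsatisfiable. *)
  have ext psi : over B psi -> ~ (p `|` X) psi -> exists p0,
      [/\ finite_set p0, p0 `<=` p `|` X & forall a, realizes p0 a -> ~ psat psi a].
    move=> opsi npsi; apply: contrapT => no.
    apply: (Xmax (psi |` X)); last split.
    - by split=> [x|/(_ psi (or_introl erefl)) h]; [right|apply: npsi; right].
    - by move=> x [->//|/oX].
    - move=> p0 fp0 p0X; apply: contrapT => no'; apply: no.
      exists (p0 `\ psi); split; first exact: finite_setD.
        by move=> x [/p0X[px|[e|Xx]] n]; [left|case: n|right].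
      move=> a ra pa; apply: no'; exists a => x p0x.
      by have [->//|xpsi] := pselect (x = psi); apply: ra.
  have [p0 [f0 s0 h0]] := ext _ ophi n1.
  have [p1 [f1 s1 h1]] := ext (pneg phi) ophi n2.
  have [||a ra] := fX (p0 `|` p1); first by rewrite finite_setU.
    by move=> x [/s0|/s1].
  by apply: (h1 a) => [x p1x|pa]; [apply: ra; right|apply: (h0 a) => // x ?; apply: ra; left].
by move=> a ra; exists a => phi pphi; apply: ra; left.
Qed.

(** No realization of [p] lies in [X], so a finite part of [p] already excludes [X]; its conjunction
    defines [Y]. This turns a fact about the locus into one about a definable set around it. *)
Lemma type_compact L kappa (C : structure L) (A B : set (elt C)) G
    (p : set (pformula C (@sort_of _ G))) (X : set (tup C G)) :
  saturated kappa C -> small kappa B -> A `<=` B -> p `<=` @over L C A _ _ ->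
  definable B X -> (forall x, locus p x -> ~ X x) ->
  exists Y, [/\ definable A Y, locus p `<=` Y & forall x, Y x -> ~ X x].
Proof.
move=> sC sB AB oA [phi ophi phiE] pX; apply: contrapT => no.
have [||||a ra] := @realize_partial L kappa C B G (phi |` p) => //.
- by move=> psi [->//|/oA o x /o /AB].
- move=> p0 fp0 p0p; apply: contrapT => no'; apply: no.
  have sp : p0 `\ phi `<=` p by move=> x [/p0p[e|//]]; case.
  exists (locus (p0 `\ phi)); split.
  + by apply: definable_realizes; [exact: finite_setD|move=> x /sp /oA].
  + by move=> x px psi /sp; exact: px.
  + move=> x hx Xx; apply: no'; exists x => psi p0psi.
    by have [->|n] := pselect (psi = phi); [apply/phiE|apply: hx].
- apply: (pX a) => [psi ppsi|]; first by apply: ra; right.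
  by apply/phiE; apply: ra; left.
Qed.

(** The graph of the partial map fixing [B] and sending [a] to [a']. It is only a relation at this
    stage: coordinates of [a] may repeat or lie in [B], and single-valuedness must come from
    equality of types. *)
Definition link L (C : structure L) (B : set (elt C)) G (a a' : tup C G) s
    (c c' : C s) : Prop :=
  (B (mk c) /\ c' = c) \/
  exists i, mk (a i) = mk c /\ mk (a' i) = mk c'.

Definition same_type L (C : structure L) (B : set (elt C)) V (sg : V -> sort L)
    (a a' : val C sg) : Prop :=
  forall X : set (val C sg), definable B X -> X a -> X a'.

(** Linked points are the values at [a] and [a'] of one coordinate map over [B], so the truth of
    [phi] becomes a [B]-definable condition on [a]. *)
Lemma link_sat L (C : structure L) (B : set (elt C)) G (a a' : tup C G)
    (V : finType) (sg : V -> sort L) (phi : formula sg) (v v' : val C sg) :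
  same_type B a a' -> (forall x, link B a a' (v x) (v' x)) ->
  sat phi v -> sat phi v'.
Proof.
move=> st lk.
have H x : exists f : tup C G -> C (sg x),
    [/\ (exists i, forall u : tup C G, mk (u i) = mk (f u)) \/
        (exists2 c, B (mk c) & forall u, f u = c), f a = v x & f a' = v' x].
  have [[Bc e]|[i [e e']]] := lk x.
    by exists (fun=> v x); split=> //; right; exists (v x).
  have [t tE] := @var_term L C _ (@sort_of _ G) i (sg x) (projT1_eq e).
  exists (fun u => eval u t); split; first by left; exists i.
    by apply: mk_inj; rewrite -tE.
  by apply: mk_inj; rewrite -tE.
pose F (u : tup C G) : val C sg := fun x => projT1 (cid (H x)) u.
have sF : simple_map B F by move=> x; case: (projT2 (cid (H x))).
have := st _ (definable_formula phi sF).
have -> : [set u | sat phi (F u)] a = sat phi v.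
  congr sat; apply: functional_extensionality_dep => x.
  by case: (projT2 (cid (H x))).
have -> // : [set u | sat phi (F u)] a' = sat phi v'.
congr sat; apply: functional_extensionality_dep => x.
by case: (projT2 (cid (H x))).
Qed.

Lemma conjugate L kappa (C : structure L) (B : set (elt C)) G (a a' : tup C G) :
  strongly_homogeneous kappa C -> small kappa [set: nat] -> small kappa B ->
  same_type B a a' -> exists g h, aut B g h /\ app g a = a'.
Proof.
move=> hom sn sB st.
(* Single-valuedness is [link_sat] for the formula x = y. *)
have link_fun s (c c1 c2 : C s) : link B a a' c c1 -> link B a a' c c2 -> c1 = c2.
  move=> l1 l2; pose sg (x : bool) := s.
  have := @link_sat L C B G a a' bool sg (Eq (Var sg true) (Var sg false))
    (fun=> c) (fun x => if x then c1 else c2) st.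
  by apply=> // -[].
(* The value at a point linked to nothing is arbitrary, since [elementary_on] only looks at [B] and
   the coordinates of [a]. *)
have H s (c : C s) : exists c', forall c'', link B a a' c c'' -> c'' = c'.
  have [[c' l]|n] := pselect (exists c', link B a a' c c').
    by exists c' => c'' l'; exact: (link_fun _ c).
  by exists c => c'' l; case: n; exists c''.
pose h s c := projT1 (cid (H s c)).
have hE s (c c' : C s) : link B a a' c c' -> c' = h s c.
  exact: (projT2 (cid (H s c))).
have lh s (c : C s) : (B `|` coords a) (mk c) -> link B a a' c (h s c).
  move=> Bc; suff [c' l] : exists c', link B a a' c c' by rewrite -(hE _ _ _ l).
  case: Bc => [Bc|[i _ e]]; first by exists c; left.
  have [c' e'] := mk_cast (a' i) (projT1_eq e).
  by exists c'; right; exists i.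
have elem : elementary_on (B `|` coords a) h.
  move=> G' phi b bB.
  have lb i : link B a a' (b i) (h _ (b i)) by apply: lh; apply: bB; exists i.
  split; first exact: link_sat st lb.
  by move=> s1; apply: contrapT => nb; exact: (link_sat (phi := Neg phi) st lb nb s1).
have sBa := small_setU sn sB (finite_coords a).
have [g ga gh] := hom _ h sBa elem.
have [g' [ga' gK Kg]] := automorphism_inv ga.
exists g, g'; split.
  split=> // s c Bc; rewrite gh; last by left.
  by apply/esym/hE; left.
apply: functional_extensionality_dep => i; rewrite /app gh; last by right; exists i.
by apply/esym/hE; right; exists i.
Qed.

(** * Generic realizations of so-pairs *)

Lemma app_vcat L (M : structure L) g V W (sg : V -> sort L) (tau : W -> sort L)
    (v : val M sg) (w : val M tau) :
  app g (vcat v w) = vcat (app g v) (app g w).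
Proof. by apply: functional_extensionality_dep; case. Qed.

Lemma definable_fiber L (M : structure L) (A B : set (elt M)) G H
    (X : set (val M (sum_sort (@sort_of _ G) (@sort_of _ H)))) (b : tup M H) :
  A `<=` B -> coords b `<=` B -> definable A X ->
  definable B [set a | X (vcat a b)].
Proof.
move=> AB bB /(definable_sub AB); apply: definable_preim => -[i|j] /=.
  by left; exists i.
by right; exists (b j) => //; apply: bB; exists j.
Qed.

Lemma definable_swap L (M : structure L) (A : set (elt M)) G H
    (X : set (val M (sum_sort (@sort_of _ G) (@sort_of _ H)))) :
  definable A X -> exists2 Z : set (val M (sum_sort (@sort_of _ H) (@sort_of _ G))),
    definable A Z & forall a b, Z (vcat b a) <-> X (vcat a b).
Proof.
move=> dX; exists [set v | X (vcat (fun i => v (inr i)) (fun i => v (inl i)))] => //.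
by apply: definable_preim dX => -[] i; left; [exists (inr i)|exists (inl i)].
Qed.

(** Parameters taken from [b] are turned into variables, so that [X] is the fibre over [b] of an
    [A]-definable relation, which automorphisms over [A] preserve. *)
Lemma definable_abstract L (M : structure L) (A : set (elt M)) G H
    (X : set (tup M G)) (b : tup M H) :
  definable (A `|` coords b) X ->
  exists2 Z : set (val M (sum_sort (@sort_of _ G) (@sort_of _ H))),
    definable A Z & forall a, X a <-> Z (vcat a b).
Proof.
move=> [phi o phiE].
have K k : exists f : tup M H -> M (sort_of k),
    ((exists j, forall u : tup M H, mk (u j) = mk (f u)) \/
     (exists2 c, A (mk c) & forall u, f u = c)) /\ f b = pars phi k.
  have [|Ak|[j _ e]] := o (mk (pars phi k)); first by exists k.
    by exists (fun=> pars phi k); split=> //; right; exists (pars phi k).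
  have [t tE] := @var_term L M _ (@sort_of _ H) j _ (projT1_eq e).
  exists (fun u => eval u t); split; first by left; exists j.
  by apply: mk_inj; rewrite -tE; exact: e.
pose F (v : val M (sum_sort (@sort_of _ G) (@sort_of _ H))) :=
  vcat (fun i => v (inl i)) (fun k => projT1 (cid (K k)) (fun j => v (inr j))).
exists [set v | sat (body phi) (F v)].
  apply: definable_formula => -[i|k] /=; first by left; exists (inl i).
  case: (cid (K k)) => f /= [[[j jE]|[c Ac cE]] _].
    by left; exists (inr j) => v; rewrite -jE.
  by right; exists c.
move=> a; rewrite -phiE /psat /=.
suff -> : F (vcat a b) = vcat a (pars phi) by [].
apply: functional_extensionality_dep => -[i|k] //=.
by case: (cid (K k)) => f /= [_ e].
Qed.

Lemma definable_move L (M : structure L) (A : set (elt M)) g h G H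
    (X : set (tup M G)) (b : tup M H) :
  aut A g h -> definable (A `|` coords (app g b)) X ->
  definable (A `|` coords b) [set x | X (app g x)].
Proof.
move=> gA [phi o phiE]; have [ga ha gK hK gf] := gA.
have hf := aut_inv gA.
exists (PFormula (body phi) (app h (pars phi))).
  move=> _ [k _ <-].
  have [|Ak|[j _ e]] := o (mk (pars phi k)); first by exists k.
    by left; have [_ _ _ _ hfix] := hf; rewrite /= /app hfix.
  right; exists j => //.
  have : mk (h _ (app g b j)) = mk (h _ (pars phi k)).
    exact: (f_equal (fun x : elt M => mk (h (projT1 x) (projT2 x))) e).
  by rewrite /app gK.
move=> x /=; rewrite -phiE -(psat_aut _ x ga) /=.
by rewrite (appK (pars phi) hf); case: phi {o phiE}.
Qed.

Section SoPairs.
Context (L : language) (kappa : Type) (C : structure L) (A : set (elt C)).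
Context (small_nat : small kappa [set: nat]) (satC : saturated kappa C)
        (homC : strongly_homogeneous kappa C) (small_A : small kappa A).

Local Notation locus_of P := (locus (type_of P)).

(** Intersecting with the locus mirrors [trace]: [eventual (psat phi)] is, by conversion, membership
    of [phi] in [left_type P]. *)
Definition eventual (P : opair C) (X : set (tup C (vars P))) : Prop :=
  left_eventual (locus_of P) (lt_of P) [set x | locus_of P x /\ X x].

(* [right_generic A P] is convertible to [left_generic A (reverse P)], so every
   statement about left generics below also serves for right generics. *)
Lemma so_reverse P : so_pair A P -> so_pair A (reverse P).
Proof.
move=> [ct inf [[irr tr tot] ltD [phi o phiE]] ev]; split => //; last first.
  by move=> psi; have [] := ev psi.
split.
- split=> //= [a b c Da Db Dc ba cb|a b Da Db]; first exact: (tr c b a).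
  by have [h|h|h] := tot a b Da Db; [apply: Or33|apply: Or32|apply: Or31].
- by move=> a b /= /ltD[].
- have [|Z [psi opsi psiE] ZE] := @definable_swap L C A _ _ (psat phi).
    by exists phi.
  by exists psi => // a b Da Db /=; rewrite psiE ZE; exact: phiE.
Qed.

Lemma eventual_mono P (X Y : set (tup C (vars P))) :
  eventual X -> (forall x, locus_of P x -> X x -> Y x) -> eventual Y.
Proof.
move=> [I [iI nI IX]] XY; exists I; split=> // x /IX[Dx Xx].
by split=> //; exact: XY.
Qed.

Section Pair.
Context (P : opair C) (soP : so_pair A P).
Local Notation D := (locus_of P).
Local Notation lt := (lt_of P).

Lemma lt_irr a : D a -> ~ lt a a.
Proof. by case: soP => _ _ [[irr _ _] _ _] _; exact: irr. Qed.

Lemma lt_locus a b : lt a b -> D a /\ D b.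
Proof. by case: soP => _ _ [_ h _] _; exact: h. Qed.

Lemma lt_tr a b c : lt a b -> lt b c -> lt a c.
Proof.
move=> ab bc; case: soP => _ _ [[_ tr _] _ _] _.
by have [Da Db] := lt_locus ab; have [_ Dc] := lt_locus bc; exact: (tr a b c).
Qed.

Lemma lt_total a b : D a -> D b -> [\/ lt a b, a = b | lt b a].
Proof. by case: soP => _ _ [[_ _ tot] _ _] _; exact: tot. Qed.

Lemma locus_aut g h a : aut A g h -> (D (app g a) <-> D a).
Proof.
move=> gA; case: soP => -[oA _ _] _ _ _.
split=> H phi pphi; have := H _ pphi.
  by move/(definable_aut a gA (ex_intro2 _ _ phi (oA _ pphi) (fun=> iff_refl _))).
by move/(definable_aut a gA (ex_intro2 _ _ phi (oA _ pphi) (fun=> iff_refl _))).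
Qed.

Lemma lt_aut g h a b : aut A g h -> lt a b -> lt (app g a) (app g b).
Proof.
move=> gA ab; have [Da Db] := lt_locus ab.
case: soP => _ _ [_ _ [phi o phiE]] _.
apply/(phiE _ _ ((locus_aut a gA).2 Da) ((locus_aut b gA).2 Db)).
rewrite -app_vcat.
apply/(definable_aut _ gA (ex_intro2 _ _ phi o (fun=> iff_refl _))).
exact/phiE.
Qed.

Lemma locus_conjugate a b : D a -> D b -> exists g h, aut A g h /\ app g a = b.
Proof.
move=> Da Db; apply: (conjugate homC) => // X [phi o phiE] Xa.
case: soP => -[_ _ dec] _ _ _; have [h|h] := dec phi o; first by apply/phiE/Db.
by move/phiE: Xa => pa; case: (Da _ h pa).
Qed.

(** The locus is infinite, so it has an element b other than a. If a were least then a < b, and an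
    automorphism carrying a to b would pull this back to an element below a. *)
Lemma lt_unbounded a : D a -> exists b, lt b a.
Proof.
move=> Da; apply: contrapT => no.
have [b Db ba] : exists2 b, D b & b <> a.
  apply: contrapT => nob; case: soP => _ inf _ _; apply: inf.
  apply: (@sub_finite_set _ _ [set a]); last exact: finite_set1.
  by move=> b Db; apply: contrapT => ba; apply: nob; exists b.
have [g [h [gA ga]]] := locus_conjugate Da Db.
have ab : lt a b by have [//|e|l] := lt_total Da Db; [case: ba|case: no; exists b].
apply: no; exists (app h a).
by have := lt_aut (aut_inv gA) ab; rewrite -ga (appK a gA).
Qed.

Lemma lt_definable c (B : set (elt C)) : D c -> coords c `<=` A `|` B ->
  exists2 X, definable (A `|` B) X & forall x, D x -> (X x <-> lt x c).
Proof.
move=> Dc cB; case: soP => _ _ [_ _ [phi o phiE]] _.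
exists [set x | psat phi (vcat x c)]; last by move=> x Dx; rewrite phiE.
apply: (@definable_fiber L C A _ _ _ [set v | psat phi v] c) => //.
by exists phi.
Qed.

Lemma eventual_true : eventual (P := P) setT.
Proof.
exists D; split=> [|| x Dx //]; first by split.
by case: soP => _ /infinite_setN0.
Qed.

Lemma eventual_and (X Y : set (tup C (vars P))) :
  eventual X -> eventual Y -> eventual [set x | X x /\ Y x].
Proof.
move=> [I [[ID iI] [i Ii] IX]] [J [[JD iJ] [j Jj] JY]].
exists (I `&` J); split.
- split=> [x [/ID //]|a b [Ia Ja] Db ba].
  by split; [exact: iI ba|exact: iJ ba].
- have [l|e|l] := lt_total (ID _ Ii) (JD _ Jj).
  + by exists i; split=> //; exact: iJ Jj (ID _ Ii) l.
  + by exists i; split=> //; rewrite e.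
  + by exists j; split=> //; exact: iI Ii (JD _ Jj) l.
- by move=> x [/IX[Dx Xx] /JY[_ Yx]].
Qed.

Lemma eventual_nonempty X : eventual (P := P) X -> exists2 x, D x & X x.
Proof. by move=> [I [_ [x Ix] /(_ _ Ix)[Dx Xx]]]; exists x. Qed.

Lemma eventual_dec B (X : set (tup C (vars P))) :
  definable B X -> ~ eventual X -> eventual [set x | ~ X x].
Proof.
move=> [phi _ phiE] nX; case: soP => _ _ _ /(_ phi)[[[h _]|[_ h]] _].
  case: nX; case: h => I [iI nI IX]; exists I; split=> // x /IX[Dx].
  by move/phiE.
case: h => I [iI nI IX]; exists I; split=> // x /IX[Dx nx]; split=> // Xx.
by apply: nx; split=> //; apply/phiE.
Qed.

Lemma eventual_lt c : D c -> eventual [set x | lt x c].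
Proof.
move=> Dc; exists [set x | lt x c]; split.
- split=> [x /lt_locus[]//|a b ac Db ba]; exact: lt_tr ba ac.
- exact: lt_unbounded.
- by move=> x xc; split=> //; have [] := lt_locus xc.
Qed.

Lemma eventual_aut g h (X : set (tup C (vars P))) :
  aut A g h -> eventual X -> eventual [set x | X (app h x)].
Proof.
move=> gA [I [[ID iI] [i Ii] IX]].
have hA := aut_inv gA.
have DI x : I (app h x) -> D x by move/ID/(locus_aut x hA).
exists [set x | I (app h x)]; split.
- split=> // a b Ia Db ba.
  by apply: iI Ia _ _; [apply/(locus_aut b hA)|exact: lt_aut hA ba].
- by exists (app g i); rewrite /= (appK _ gA).
- by move=> x Ix; split; [exact: DI|have [] := IX _ Ix].
Qed.

Lemma genericP B a : left_generic A P a B <->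
  forall X, definable (A `|` B) X -> eventual X -> X a.
Proof.
split=> [ga X [phi o phiE] eX|ga phi [lphi o]].
  apply/phiE; apply: ga; split=> //; have [I [iI nI IX]] := eX.
  by exists I; split=> // x /IX[Dx /phiE].
by apply: (ga (psat phi)) => //; exists phi.
Qed.

Lemma generic_locus B a : left_generic A P a B -> D a.
Proof.
move=> /genericP ga phi pphi; apply: (ga (psat phi)).
  exists phi => // x xp; left; move: x xp.
  by case: soP => -[oA _ _] _ _ _; exact: oA.
by apply: eventual_mono eventual_true _ => x Dx _; exact: Dx.
Qed.

Lemma generic_sub B B' a :
  B `<=` B' -> left_generic A P a B' -> left_generic A P a B.
Proof. by move=> BB ga phi [lphi o]; apply: ga; split=> // x /o [?|/BB]; [left|right]. Qed.

Lemma eventual_finite p0 : finite_set p0 ->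
  (forall phi, p0 phi -> eventual (P := P) (psat phi)) ->
  eventual (P := P) (locus p0).
Proof.
move: p0; apply: finite_set_induct => [_|phi p0 IH ev].
  by apply: eventual_mono eventual_true _ => x _ _ phi [].
have := eventual_and (ev phi (or_introl erefl)) (IH (fun x px => ev x (or_intror px))).
by move=> h; apply: eventual_mono h _ => x Dx [h1 h2] psi [->//|/h2].
Qed.

Lemma exists_generic B : finite_set B -> exists a, left_generic A P a B.
Proof.
move=> fB; apply: (satC (small_setU small_nat small_A fB)).
split=> [phi []//|p0 fp0 p0s|phi o].
  have : eventual (P := P) (locus p0).
    by apply: eventual_finite => // phi /p0s[].
  by move=> /eventual_nonempty[a _ ra]; exists a.
have dphi : definable (A `|` B) (psat phi) by exists phi.
have [e|e] := pselect (eventual (P := P) (psat phi)); first by left; split.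
right; split=> //; exact: eventual_dec dphi e.
Qed.

Lemma generic_same_type B a a' : left_generic A P a B -> left_generic A P a' B ->
  same_type (A `|` B) a a'.
Proof.
move=> /genericP ga /genericP ga' X dX Xa; apply: ga' => //.
apply: contrapT => /(eventual_dec dX) nX.
exact: (ga _ (definable_not dX) nX).
Qed.

Lemma generic_conjugate B a a' : finite_set B ->
  left_generic A P a B -> left_generic A P a' B ->
  exists g h, aut (A `|` B) g h /\ app g a = a'.
Proof.
move=> fB ga ga'; apply: (conjugate homC) => //; first exact: small_setU.
exact: generic_same_type ga ga'.
Qed.

Lemma generic_lt B a c : left_generic A P a B -> D c ->
  coords c `<=` A `|` B -> lt a c.
Proof.
move=> ga Dc cB; have [X dX XE] := lt_definable Dc cB.
apply/(XE _ (generic_locus ga)); have /genericP := ga; apply => //.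
by apply: eventual_mono (eventual_lt Dc) _ => x Dx xc; apply/(XE x Dx).
Qed.

(** An eventual [X] over [A] and [B] contains an initial segment [I]. Pick a generic c' below an
    element c of [I]; an automorphism over [A] and [B] taking [a] to c' takes [b] below c', hence
    into [I], and leaves [X] invariant. *)
Lemma generic_initial B a b : finite_set B -> left_generic A P a B ->
  lt b a -> left_generic A P b B.
Proof.
move=> fB ga ba; apply/genericP => X dX [I [[ID iI] [c Ic] IX]].
have [|c' gc'] := @exists_generic (B `|` coords c).
  by rewrite finite_setU; split=> //; exact: finite_coords.
have c'c : lt c' c.
  by apply: generic_lt gc' _ _; [exact: ID|move=> x; right; right].
have gB : left_generic A P c' B by apply: generic_sub gc' => x; left.
have [g [h [gA ge]]] := generic_conjugate fB gB ga.
have hA := aut_inv gA.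
apply/(definable_aut b hA dX).
have hb : lt (app h b) c'.
  by rewrite -(appK c' gA) ge; apply: lt_aut ba; apply: aut_sub hA => x; left.
have := lt_tr hb c'c => hc; have [Dh _] := lt_locus hc.
by have [] := IX _ (iI _ _ Ic Dh hc).
Qed.

Lemma generic_aut g h a G (b : tup C G) : aut A g h ->
  left_generic A P a (coords b) -> left_generic A P (app g a) (coords (app g b)).
Proof.
move=> gA /genericP ga; apply/genericP => X dX eX.
apply: (ga [set x | X (app g x)]); first exact: definable_move gA dX.
exact: eventual_aut (aut_inv gA) eX.
Qed.

(** Some definable eventual set misses [a]; its complement lies above any point of the initial
    segment that the set contains. *)
Lemma nongeneric_bounded B a : D a -> ~ left_generic A P a B ->
  exists X, [/\ definable (A `|` B) X, X a &
    exists2 c, D c & forall x, D x -> X x -> lt c x].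
Proof.
move=> Da nga; have [X [dX eX nX]] : exists X, [/\ definable (A `|` B) X,
    eventual X & ~ X a].
  apply: contrapT => no; apply: nga; apply/genericP => X dX eX.
  by apply: contrapT => nX; apply: no; exists X.
exists [set x | ~ X x]; split=> //; first exact: definable_not.
have [I [[ID iI] [c Ic] IX]] := eX; exists c; first exact: ID.
move=> x Dx nx; have [//|e|l] := lt_total (ID _ Ic) Dx.
  by case: nx; rewrite -e; have [] := IX _ Ic.
by case: nx; have [] := IX _ (iI _ _ Ic Dx l).
Qed.

End Pair.

(** * Direct nonorthogonality *)

Lemma locus_nonempty P : so_pair A P -> exists a, locus_of P a.
Proof. by move=> [_ /infinite_setN0]. Qed.

Lemma generic_pair_conjugate P Q a b a' b' : so_pair A P -> so_pair A Q ->
  locus_of Q b -> locus_of Q b' ->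
  left_generic A P a (coords b) -> left_generic A P a' (coords b') ->
  exists g h, [/\ aut A g h, app g a = a' & app g b = b'].
Proof.
move=> sP sQ Db Db' ga ga'.
have [g [h [gA ge]]] := locus_conjugate sQ Db Db'.
have := generic_aut sP gA ga; rewrite ge => ga1.
have [g' [h' [gA' ge']]] := generic_conjugate sP (finite_coords b') ga1 ga'.
exists (fun s c => g' s (g s c)), (fun s c => h s (h' s c)); split.
- by apply: aut_comp gA; apply: aut_sub gA' => x; left.
- exact: ge'.
- by rewrite -[RHS](app_fix gA') -?ge // => x; rewrite ge; right.
Qed.

(** Pairs with a left P-generic over b form one orbit, and so do pairs with b left Q-generic over a.
    A common pair makes the two orbits equal. *)
Lemma generic_swap P Q a0 b0 : so_pair A P -> so_pair A Q ->
  left_generic A P a0 (coords b0) -> left_generic A Q b0 (coords a0) ->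
  forall a b, locus_of P a -> locus_of Q b ->
  left_generic A P a (coords b) <-> left_generic A Q b (coords a).
Proof.
move=> sP sQ ga gb a b Da Db.
have Da0 := generic_locus sP ga; have Db0 := generic_locus sQ gb.
split=> g1.
  have [g [h [gA <- <-]]] := generic_pair_conjugate sP sQ Db0 Db ga g1.
  exact: (generic_aut sQ gA gb).
have [g [h [gA <- <-]]] := generic_pair_conjugate sQ sP Da0 Da gb g1.
exact: (generic_aut sP gA ga).
Qed.

(* The sets [{b | a is left generic over b}] form a chain of conjugates; if one
   of them were bounded by an interval, moving that interval off itself would
   produce two disjoint members of the chain. *)
Lemma generic_dichotomy P Q : so_pair A P -> so_pair A Q ->
  (forall a b, locus_of P a -> locus_of Q b ->
    left_generic A P a (coords b) <-> left_generic A Q b (coords a)) \/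
  (forall a b, locus_of P a -> locus_of Q b ->
    left_generic A P a (coords b) <-> right_generic A Q b (coords a)).
Proof.
move=> sP sQ; have sQ' := so_reverse sQ.
have [b0 Db0] := locus_nonempty sQ.
have [a0 ga0] := exists_generic sP (finite_coords b0).
have Da0 := generic_locus sP ga0.
have [gl|nl] := pselect (left_generic A Q b0 (coords a0)).
  by left; exact: generic_swap ga0 gl.
have [gr|nr] := pselect (left_generic A (reverse Q) b0 (coords a0)).
  by right; exact: (generic_swap sP sQ' ga0 gr).
exfalso.
have [X [dX Xb0 [c Dc cX]]] := nongeneric_bounded sQ Db0 nl.
have [Y [dY Yb0 [d Dd dYX]]] := nongeneric_bounded sQ' Db0 nr.
have [g [h [gA gc]]] := locus_conjugate sQ Dc Dd.
have between b : left_generic A P a0 (coords b) -> locus_of Q b ->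
    lt_of Q c b /\ lt_of Q b d.
  move=> gb Db.
  have [k [l [kA ka kb]]] := generic_pair_conjugate sP sQ Db0 Db ga0 gb.
  have moveX Z : definable (A `|` coords a0) Z -> Z b0 -> Z b.
    move=> dZ Zb0; rewrite -ka in dZ.
    have := definable_move kA dZ.
    rewrite -kb => dZ'.
    have [m Zm mE] := definable_abstract dZ.
    apply/mE; rewrite -app_vcat.
    by apply/(definable_aut _ kA Zm); move/mE: Zb0; rewrite ka.
  by split; [apply: cX|apply: dYX] => //; apply: moveX.
have Dgb0 := (locus_aut sQ b0 gA).2 Db0.
have Dga0 := (locus_aut sP a0 gA).2 Da0.
have gg := generic_aut sP gA ga0.
have [cb0 b0d] := between _ ga0 Db0.
have dgb0 : lt_of Q d (app g b0) by rewrite -gc; exact: (lt_aut sQ gA cb0).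
have contra1 : ~ left_generic A P a0 (coords (app g b0)).
  move=> /between /(_ Dgb0)[_ gb0d].
  exact: (lt_irr sQ Dd (lt_tr sQ dgb0 gb0d)).
(* The smaller of [a0] and [app g a0] is left generic over both [b0] and [app g b0]. If it is [a0],
   then [app g b0] lies below d; if it is [app g a0], pulling back by [h] puts [app h b0] above c.
   Both contradict g c = d. *)
have [l|e|l] := lt_total sP Da0 Dga0.
- exact/contra1/(generic_initial sP (finite_coords _) gg l).
- by apply: contra1; rewrite e.
- have g2 := generic_initial sP (finite_coords _) ga0 l.
  have := generic_aut sP (aut_inv gA) g2; rewrite (appK a0 gA).
  move=> /between /(_ ((locus_aut sQ b0 (aut_inv gA)).2 Db0))[chb0 _].
  have := lt_aut sQ gA chb0; rewrite gc (appK b0 (aut_inv gA)) => db0.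
  exact: (lt_irr sQ Dd (lt_tr sQ db0 b0d)).
Qed.

(** Points below [a] are left generic over [b]; points above [a] are right generic, hence of the
    same type over [b] as [a]. So the whole locus of P realizes one type over [b], and moving other
    realizations of Q to [b] gives weak orthogonality. *)
Lemma generic_left_right_absurd P Q a b : so_pair A P -> so_pair A Q ->
  pairs_not_weakly_orthogonal A P Q -> locus_of Q b ->
  left_generic A P a (coords b) -> right_generic A P a (coords b) -> False.
Proof.
move=> sP sQ nw Db gl gr; apply: nw => phi o /=.
have Da := generic_locus sP gl; have sP' := so_reverse sP.
have all x : locus_of P x -> left_generic A P x (coords b).
  move=> Dx; have [l|e|l] := lt_total sP Dx Da.
  - exact: (generic_initial sP (finite_coords _) gl l).
  - by rewrite e.
  - have gx := generic_initial sP' (finite_coords b) gr l.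
    apply/genericP => X dX eX; have st := generic_same_type sP' gr gx.
    apply: (st X dX); have /genericP := gl; exact.
apply: contrapT => /not_orP[n1 n2].
have dphi : definable A (psat phi) by exists phi.
have [a1 [b1 [Da1 Db1 ph1]]] : exists a1 b1, [/\ locus_of P a1, locus_of Q b1 &
    psat phi (vcat a1 b1)].
  apply: contrapT => no; apply: n2 => a1 b1 Da1 Db1 ph1; apply: no.
  by exists a1, b1.
have [a2 [b2 [Da2 Db2 ph2]]] : exists a2 b2, [/\ locus_of P a2, locus_of Q b2 &
    ~ psat phi (vcat a2 b2)].
  apply: contrapT => no; apply: n1 => a2 b2 Da2 Db2; apply: contrapT => ph2.
  by apply: no; exists a2, b2.
have [g1 [h1 [gA1 ge1]]] := locus_conjugate sQ Db1 Db.
have [g2 [h2 [gA2 ge2]]] := locus_conjugate sQ Db2 Db.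
have ga1 := all _ ((locus_aut sP a1 gA1).2 Da1).
have ga2 := all _ ((locus_aut sP a2 gA2).2 Da2).
have dX : definable (A `|` coords b) [set x | psat phi (vcat x b)].
  by apply: (definable_fiber (A := A)) dphi => x; [left|right].
have := generic_same_type sP ga1 ga2 dX.
rewrite /= -{1}ge1 -ge2 -!app_vcat => H.
have ph1' : psat phi (app g1 (vcat a1 b1)) by apply/(definable_aut _ gA1 dphi).
by have /(definable_aut _ gA2 dphi) := H ph1'.
Qed.

(** Over [b] the type of P has a single completion, which is the generic one. *)
Lemma weakly_orthogonal_generic P Q a b : so_pair A P -> so_pair A Q ->
  weakly_orthogonal A (ftype_of P) (ftype_of Q) -> locus_of P a ->
  locus_of Q b -> left_generic A P a (coords b).
Proof.
move=> sP sQ wo Da Db; have [a0 ga0] := exists_generic sP (finite_coords b).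
apply/genericP => X dX eX.
have Xa0 : X a0 by move/genericP: ga0; apply.
have [Z [phi o phiE] ZE] := definable_abstract dX.
apply/ZE/phiE; have [h|h] := wo phi o; first exact: h.
have /ZE/phiE p0 := Xa0.
by case: (h a0 b (generic_locus sP ga0) Db p0).
Qed.

Lemma weakly_orthogonal_sym p q :
  weakly_orthogonal A p q -> @weakly_orthogonal L C A q p.
Proof.
move=> wo phi o; have [|Z [psi opsi psiE] ZE] := @definable_swap L C A _ _ (psat phi).
  by exists phi.
have [h|h] := wo psi opsi; [left|right] => b a qb pa.
  by apply/ZE/psiE; exact: h.
by move=> /ZE/psiE; exact: (h a b pa qb).
Qed.

Lemma nwo_sym P Q : pairs_not_weakly_orthogonal A P Q ->
  pairs_not_weakly_orthogonal A Q P.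
Proof. by move=> nw /weakly_orthogonal_sym. Qed.

Lemma nwo_refl P : so_pair A P -> pairs_not_weakly_orthogonal A P P.
Proof.
move=> sP wo; have [a Da] := locus_nonempty sP.
have ga := weakly_orthogonal_generic sP sP wo Da Da.
by apply: (lt_irr sP Da); apply: (generic_lt sP ga Da) => x; right.
Qed.

(** The dichotomy is applied to P and to its reverse. If left and right P-generics corresponded to
    the same side of Q, some a would be generic on both sides over b. *)
Lemma delta_or P Q : so_pair A P -> so_pair A Q ->
  pairs_not_weakly_orthogonal A P Q -> delta A P Q \/ delta A P (reverse Q).
Proof.
move=> sP sQ nw; have sP' := so_reverse sP.
have no (R : opair C) : so_pair A R ->
    (forall a b, locus_of P a -> locus_of R b ->
      left_generic A P a (coords b) <-> left_generic A R b (coords a)) ->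
    (forall a b, locus_of P a -> locus_of R b ->
      right_generic A P a (coords b) <-> left_generic A R b (coords a)) ->
    pairs_not_weakly_orthogonal A P R -> False.
  move=> sR h1 h2 nwR; have [b Db] := locus_nonempty sR.
  have [a ga] := exists_generic sP (finite_coords b).
  have Da := generic_locus sP ga.
  apply: (generic_left_right_absurd sP sR nwR Db ga).
  by apply/(h2 _ _ Da Db)/(h1 _ _ Da Db).
have [h1|h1] := generic_dichotomy sP sQ; have [h2|h2] := generic_dichotomy sP' sQ.
- by case: (no Q).
- right; split=> // a b Da Db.
  by split; [exact: h1|exact: h2].
- left; split=> // a b Da Db.
  by split; [exact: h1|exact: h2].
- by case: (no (reverse Q) (so_reverse sQ)).
Qed.

Lemma delta_sym (P Q : opair C) : delta A P Q -> delta A Q P.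
Proof.
move=> [nw dPQ]; split=> [|b a Db Da]; first exact: nwo_sym.
by have [h1 h2] := dPQ a b Da Db; split; apply: iff_sym; [exact: h2|exact: h1].
Qed.

Lemma delta_reverse (P Q : opair C) : delta A P Q -> delta A (reverse P) (reverse Q).
Proof.
move=> [nw dPQ]; split=> // a b Da Db; have [h1 h2] := dPQ a b Da Db.
by split; [exact: h2|exact: h1].
Qed.

Lemma reverseK (P : opair C) : reverse (reverse P) = P.
Proof. by case: P. Qed.

Lemma delta_not_both P Q : so_pair A P -> so_pair A Q ->
  delta A P Q -> delta A P (reverse Q) -> False.
Proof.
move=> sP sQ [nw d1] [_ d2]; have [b Db] := locus_nonempty sQ.
have [a ga] := exists_generic sP (finite_coords b).
have Da := generic_locus sP ga.
apply: (generic_left_right_absurd sQ sP (nwo_sym nw) Da (a := b)).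
  by apply/(d2 a b Da Db).1.
by apply/(d1 a b Da Db).1.
Qed.

(** Under delta(P, reverse P), a left generic over b forces b left generic over a, so each is
    smaller than the other. *)
Lemma delta_refl P : so_pair A P -> delta A P P.
Proof.
move=> sP; have [//|[_ d]] := delta_or sP sP (nwo_refl sP).
have [b Db] := locus_nonempty sP.
have [a ga] := exists_generic sP (finite_coords b).
have Da := generic_locus sP ga.
have gb : left_generic A P b (coords a) by apply/(d a b Da Db).1.
case: (lt_irr sP Da); apply: (@lt_tr P sP _ b).
  by apply: (generic_lt sP ga Db) => x; right.
by apply: (generic_lt sP gb Da) => x; right.
Qed.

(** Through delta the claim concerns b right generic over a, and right generics over a form a final
    segment. *)
Lemma delta_mono P Q a b b' : so_pair A P -> so_pair A Q -> delta A P Q ->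
  lt_of Q b b' -> left_generic A P a (coords b) ->
  left_generic A P a (coords b').
Proof.
move=> sP sQ [_ d] bb' ga; have Da := generic_locus sP ga.
have [Db Db'] := lt_locus sQ bb'.
apply/(d a b' Da Db').1.
apply: (generic_initial (so_reverse sQ) (finite_coords a) _ bb').
exact/(d a b Da Db).1.
Qed.

Lemma generic_lt_nonleft P b b' B : so_pair A P -> finite_set B ->
  left_generic A P b B -> locus_of P b' -> ~ left_generic A P b' B ->
  lt_of P b b'.
Proof.
move=> sP fB gb Db' nb'; have Db := generic_locus sP gb.
have [//|e|l] := lt_total sP Db Db'; case: nb'; first by rewrite -e.
exact: (generic_initial sP fB gb l).
Qed.

(** Choose [b1] right generic over [a] and [c1] right generic over both. Since [c1] and [c] are
    right generic over [a], an automorphism fixing [a] takes [c1] to [c], and the image of [b1] is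
    the interpolant. *)
Lemma generic_between P Q R a c : so_pair A P -> so_pair A Q -> so_pair A R ->
  delta A P Q -> delta A Q R -> locus_of P a ->
  right_generic A R c (coords a) ->
  exists b, left_generic A P a (coords b) /\ left_generic A Q b (coords c).
Proof.
move=> sP sQ sR [_ dPQ] [_ dQR] Da gc.
have sQ' := so_reverse sQ; have sR' := so_reverse sR.
have [b1 gb1] := exists_generic sQ' (finite_coords a).
have [|c1 gc1] := @exists_generic _ sR' (coords b1 `|` coords a).
  by rewrite finite_setU; split; exact: finite_coords.
have gc1a : left_generic A (reverse R) c1 (coords a).
  by apply: generic_sub gc1 => x; right.
have gc1b : left_generic A (reverse R) c1 (coords b1).
  by apply: generic_sub gc1 => x; left.
have [g [h [gA ge]]] := generic_conjugate sR' (finite_coords a) gc1a gc.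
have gA' : aut A g h by apply: aut_sub gA => x; left.
have ga : app g a = a by apply: (app_fix gA) => x; right.
have gb := generic_aut sQ' gA' gb1; rewrite ga in gb.
have gcb := generic_aut sR' gA' gc1b; rewrite ge in gcb.
exists (app g b1); have Db := generic_locus sQ' gb.
have Dc := generic_locus sR' gcb.
by split; [apply/(dPQ _ _ Da Db).1|apply/(dQR _ _ Db Dc).1].
Qed.

(** The last hypothesis is what the two ways of failing delta(P, R) have in common: weak
    orthogonality and delta(P, reverse R) both imply it. *)
Lemma delta_trans_absurd P Q R : so_pair A P -> so_pair A Q -> so_pair A R ->
  delta A P Q -> delta A Q R ->
  (forall a c, locus_of P a -> locus_of R c ->
    right_generic A P a (coords c) -> right_generic A R c (coords a)) -> False.
Proof.
move=> sP sQ sR dPQ dQR H; have [c Dc] := locus_nonempty sR.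
have sP' := so_reverse sP; have sQ' := so_reverse sQ.
have [b0 gb0] := exists_generic sQ' (finite_coords c).
have Db0 := generic_locus sQ' gb0.
have [|a ga] := @exists_generic _ sP' (coords b0 `|` coords c).
  by rewrite finite_setU; split; exact: finite_coords.
have gac : right_generic A P a (coords c) by apply: generic_sub ga => x; right.
have gab : right_generic A P a (coords b0) by apply: generic_sub ga => x; left.
have Da := generic_locus sP' ga.
have gc := H a c Da Dc gac.
(* This [b] is left generic over [c] while [b0] is right generic over [c], so [b] is below [b0];
   monotonicity then makes [a] left generic over [b0], over which it was chosen right generic. *)
have [b [gb gbc]] := generic_between sP sQ sR dPQ dQR Da gc.
have bb0 : lt_of Q b b0.
  apply: (generic_lt_nonleft sQ (finite_coords c) gbc Db0) => gl.
  by case: dQR => nw _; exact: (generic_left_right_absurd sQ sR nw Dc gl gb0).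
have gl := delta_mono sP sQ dPQ bb0 gb.
by case: dPQ => nw _; exact: (generic_left_right_absurd sP sQ nw Db0 gl gab).
Qed.

Lemma delta_trans P Q R : so_pair A P -> so_pair A Q -> so_pair A R ->
  delta A P Q -> delta A Q R -> delta A P R.
Proof.
move=> sP sQ sR dPQ dQR; have abs := delta_trans_absurd sP sQ sR dPQ dQR.
have [|//|[_ d]] := @delta_or P R sP sR.
  move=> wo; apply: abs => a c Da Dc _.
  exact: (weakly_orthogonal_generic (so_reverse sR) sP (weakly_orthogonal_sym wo) Dc Da).
by case: abs => a c Da Dc /(d a c Da Dc).2.
Qed.

(** Lets Q be oriented in agreement with P; weak orthogonality and nongenericity do not see the
    orientation. *)
Lemma nwo_delta P Q : so_pair A P -> so_pair A Q ->
  pairs_not_weakly_orthogonal A P Q ->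
  exists Q', [/\ so_pair A Q', Q' = Q \/ Q' = reverse Q & delta A P Q'].
Proof.
move=> sP sQ nw; have [d|d] := delta_or sP sQ nw; first by exists Q; split=> //; left.
by exists (reverse Q); split; [exact: so_reverse|right|].
Qed.

Lemma nwo_trans P Q R : so_pair A P -> so_pair A Q -> so_pair A R ->
  pairs_not_weakly_orthogonal A P Q -> pairs_not_weakly_orthogonal A Q R ->
  pairs_not_weakly_orthogonal A P R.
Proof.
move=> sP sQ sR nPQ nQR.
have [Q' [sQ' eQ dPQ]] := nwo_delta sP sQ nPQ.
have nQR' : pairs_not_weakly_orthogonal A Q' R by case: eQ => ->.
have [R' [sR' eR dQR]] := nwo_delta sQ' sR nQR'.
by have [] := delta_trans sP sQ' sR' dPQ dQR; case: eR => ->.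
Qed.

(** * Forking *)

(** Eventual formulas decide every formula and are closed under finite conjunction and automorphisms
    over [A]. So one of the dividing formulas is eventual, hence so are its conjugates, and any [k]
    of them have a common point. *)
Lemma generic_not_forks P B a : so_pair A P ->
  left_generic A P a B -> ~ forks A (tp a (A `|` B)).
Proof.
move=> sP ga [n [phi [p0 [div fin p0tp cov]]]].
have e0 : forall psi, p0 psi -> eventual (P := P) (psat psi).
  move=> psi /p0tp[o pa]; apply: contrapT => ne.
  have d : definable (A `|` B) (psat psi) by exists psi.
  have /genericP := ga; move=> /(_ _ (definable_not d) (eventual_dec sP d ne)).
  exact.
have [l el] : exists l, eventual (P := P) (psat (phi l)).
  apply: contrapT => no.
  have /(eventual_nonempty (P := P))[x Dx rx] : eventual (P := P)
      (locus (p0 `|` range (fun l => pneg (phi l)))).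
    apply: eventual_finite => //.
      by rewrite finite_setU; split=> //; apply: finite_image; exact: finite_finset.
    move=> psi [/e0//|[l _ <-]].
    apply: (@eventual_dec P sP (coords (pars (phi l)))) => [|e].
      by exists (phi l).
    by apply: no; exists l.
  have [|l pl] := cov x; first by move=> psi ppsi; apply: rx; left.
  by apply: (rx (pneg (phi l))) pl; right; exists l.
have [k [b [bp inc]]] := div l.
have /(eventual_nonempty (P := P))[x Dx rx] : eventual (P := P)
    (locus [set PFormula (body (phi l)) (b i) | i in [set` iota 0 k]]).
  apply: eventual_finite => //.
    by apply: finite_image; exact: finite_seq.
  move=> _ [i _ <-].
  have [g [h [gA ge]]] : exists g h, aut A g h /\ app g (pars (phi l)) = b i.
    apply: (conjugate homC) => // X [psi o psiE] /psiE pa.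
    by apply/psiE; apply: bp; split.
  apply: eventual_mono (eventual_aut sP gA el) _ => x _ /= px.
  have [g1 _ _ _ _] := gA.
  by rewrite -ge -(appK x (aut_inv gA)); apply/(psat_aut (phi l)).
apply: (inc (iota 0 k)); [exact: iota_uniq|exact: size_iota|].
by exists x => i ik; apply: rx; exists i.
Qed.

Lemma aut_iter g h (B : set (elt C)) i : aut B g h ->
  aut B (fun s => iter i (g s)) (fun s => iter i (h s)).
Proof.
move=> gA; elim: i => [|i IH]; first by split=> //; split=> // s; exists id.
have := aut_comp gA IH.
suff -> : (fun s c => iter i (h s) (h s c)) = (fun s => iter i.+1 (h s)) by [].
apply: functional_extensionality_dep => s; apply: functional_extensionality_dep => c.
by rewrite iterSr.
Qed.

(* A formula of [tp(a/AB)] with trace inside an interval [(c, d)] divides: an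
   automorphism taking [c] to a right generic over [d] moves the interval off
   itself, and its iterates give pairwise inconsistent conjugates. Compactness
   makes the inconsistency visible outside the locus of [P]. *)
Lemma nongeneric_forks P B a : so_pair A P -> finite_set B -> locus_of P a ->
  ~ left_generic A P a B -> ~ right_generic A P a B ->
  forks A (tp a (A `|` B)).
Proof.
move=> sP fB Da nl nr; have sP' := so_reverse sP.
have [X1 [dX1 X1a [c Dc cX1]]] := nongeneric_bounded sP Da nl.
have [X2 [dX2 X2a [d Dd dX2']]] := nongeneric_bounded sP' Da nr.
have [e ge] := exists_generic sP' (finite_coords d).
have De := generic_locus sP' ge.
have cd : lt_of P c d := lt_tr sP (cX1 a Da X1a) (dX2' a Da X2a).
have de : lt_of P d e by apply: (generic_lt sP' ge Dd) => x; right.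
have [f [f' [fA fc]]] := locus_conjugate sP Dc De.
have [O [dO OE]] : exists O : set (val C (sum_sort (@sort_of _ (vars P))
    (@sort_of _ (vars P)))), definable A O /\
    forall u v, locus_of P u -> locus_of P v -> (lt_of P u v <-> O (vcat u v)).
  case: sP => _ _ [_ _ [phi o phiE]] _; exists (psat phi); split=> //.
  by exists phi.
have dOl u (B' : set (elt C)) : A `<=` B' -> coords u `<=` B' ->
    definable B' [set x | O (vcat x u)].
  by move=> AB uB; exact: definable_fiber dO.
have [O' dO' O'E] := definable_swap dO.
have dOr u (B' : set (elt C)) : A `<=` B' -> coords u `<=` B' ->
    definable B' [set x | O (vcat u x)].
  move=> AB uB; have := definable_fiber AB uB dO'.
  by apply: definable_ext => x; exact: O'E.
pose B1 := A `|` (B `|` (coords c `|` (coords d `|` coords e))).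
have sB1 : small kappa B1.
  apply: small_setU => //; rewrite !finite_setU.
  by split=> //; do 2 (split; first exact: finite_coords); exact: finite_coords.
have AB1 : A `<=` B1 by move=> x; left.
have cB1 : coords c `<=` B1 by move=> x; right; right; left.
have dB1 : coords d `<=` B1 by move=> x; right; right; right; left.
have eB1 : coords e `<=` B1 by move=> x; right; right; right; right.
have BB1 : A `|` B `<=` B1 by move=> x [|]; [left|right; left].
have pA : type_of P `<=` @over L C A _ _ by case: sP => -[].
pose X := [set x | X1 x /\ X2 x].
have dX : definable (A `|` B) X := definable_and dX1 dX2.
(* On [Y1] the set [X] stays between c and d with respect to [O], even off the locus, where [O] need
   not be an order. *)
have [|x Dx|Y1 [dY1 DY1 Y1X]] := @type_compact L kappa C A B1 _ (type_of P)
    [set x | X x /\ ~ (O (vcat c x) /\ O (vcat x d))] satC sB1 AB1 pA.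
- apply: definable_and; first exact: definable_sub BB1 dX.
  by apply: definable_not; apply: definable_and; [exact: dOr|exact: dOl].
- move=> [[X1x X2x]]; apply; split; apply/OE => //; [exact: cX1|exact: dX2'].
(* On [Y2] no point is both before d and after e. *)
have [|x Dx|Y2 [dY2 DY2 Y2X]] := @type_compact L kappa C A B1 _ (type_of P)
    [set x | O (vcat x d) /\ O (vcat e x)] satC sB1 AB1 pA.
- by apply: definable_and; [exact: dOl|exact: dOr].
- move=> [/(OE _ _ Dx Dd) xd /(OE _ _ De Dx) ex].
  exact: (lt_irr sP Dx (lt_tr sP xd (lt_tr sP de ex))).
have AAB : A `<=` A `|` B by move=> x; left.
have [psi opsi psiE] := definable_and dX
  (definable_and (definable_sub AAB dY1) (definable_sub AAB dY2)).
have pa : psat psi a by apply/psiE; split=> //; split; [exact: DY1|exact: DY2].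
exists 1%N, (fun=> psi), [set psi]; split; last 1 first.
- by move=> x rx; exists ord0; exact: rx.
- move=> _; pose F i : forall s, C s -> C s := fun s => iter i (f s).
  pose F' i : forall s, C s -> C s := fun s => iter i (f' s).
  have FA i : aut A (F i) (F' i) by exact: aut_iter.
  (* The arity of inconsistency is 2: translates of [psi] by two distinct powers of [f] have no
     common point. *)
  exists 2, (fun i => app (F i) (pars psi)); split.
    move=> i chi [o pc].
    by apply/(definable_aut _ (FA i) (ex_intro2 _ _ chi o (fun=> iff_refl _))).
  (* As c < e, applying [f] gives e < f e, so the powers of [f] push e upward inside the final
     segment of right generics over d. *)
  have sepF m : right_generic A P (app (F m) e) (coords d).
    elim: m => [|m IH]; first exact: ge.
    apply: (generic_initial sP' (finite_coords d) IH).
    have -> : app (F m.+1) e = app (F m) (app f e).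
      by apply: functional_extensionality_dep => i; rewrite /app /F iterSr.
    have efe : lt_of P e (app f e).
      by rewrite -{1}fc; apply: (lt_aut sP fA); exact: lt_tr cd de.
    exact: (lt_aut sP (FA m) efe).
  have lt_absurd i j x : (i < j)%N ->
      psat (PFormula (body psi) (app (F i) (pars psi))) x ->
      psat (PFormula (body psi) (app (F j) (pars psi))) x -> False.
    move=> ij; have [m mE] : exists m, j = (i + m.+1)%N.
      by exists (j - i.+1)%N; rewrite addnS -addSn subnKC.
    have [Fi _ _ _ _] := FA i; have [Fj _ _ _ _] := FA j.
    rewrite -{1}(appK x (aut_inv (FA i))) => /(psat_aut psi _ Fi)/psiE[Xi [Y1i Y2i]].
    rewrite -{1}(appK x (aut_inv (FA j))) => /(psat_aut psi _ Fj)/psiE[Xj [Y1j _]].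
    have /not_andP[//|/contrapT[_ Oid]] := Y1X _ Y1i.
    have /not_andP[//|/contrapT[Ojc _]] := Y1X _ Y1j.
    have OA u v k : O (vcat u v) -> O (vcat (app (F k) u) (app (F k) v)).
      by move=> Ouv; rewrite -app_vcat; apply/(definable_aut _ (FA k) dO).
    have := OA _ _ i Oid; rewrite (appK _ (aut_inv (FA i))) => Oxd.
    have := OA _ _ j Ojc; rewrite (appK _ (aut_inv (FA j))) => Ocx.
    have Y2x : Y2 x.
      rewrite -(appK x (aut_inv (FA i))).
      exact/(definable_aut _ (FA i) dY2).
    have gj : right_generic A P (app (F j) c) (coords (app (F i) d)).
      have -> : app (F j) c = app (F i) (app (F m) e).
        rewrite -fc mE; apply: functional_extensionality_dep => k.
        by rewrite /app /F iterD iterSr.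
      exact: (generic_aut sP' (FA i) (sepF m)).
    (* [Y2X] speaks of the pair (d, e) only. The pair formed by [app (F i) d] and [app (F j) c] is
       conjugate to it over [A], and x lies before the first and after the second. *)
    have [g [h [gA gE gD]]] := generic_pair_conjugate sP' sP Dd
      ((locus_aut sP d (FA i)).2 Dd) ge gj.
    apply: (Y2X (app h x)); first exact/(definable_aut _ (aut_inv gA) dY2).
    split; apply/(definable_aut _ gA dO); rewrite app_vcat (appK x (aut_inv gA)).
      by rewrite gD.
    by rewrite gE.
  move=> [|i [|j []]] //= /andP[ij _] _ [x xE].
  have pi : psat (PFormula (body psi) (app (F i) (pars psi))) x.
    by apply: xE; rewrite mem_head.
  have pj : psat (PFormula (body psi) (app (F j) (pars psi))) x.
    by apply: xE; rewrite !inE eqxx orbT.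
  have [l|l|E] := ltngtP i j; first exact: lt_absurd l pi pj.
    exact: lt_absurd l pj pi.
  by move: ij; rewrite E inE eqxx.
- exact: finite_set1.
- by move=> _ ->; split.
Qed.

(** For [a] in the locus this is forking of [a] with [B] over [A] when [B] consists of the
    coordinates of a tuple; from here on forking is handled through the order. *)
Definition nongeneric (P : opair C) (a : tup C (vars P)) (B : set (elt C)) :=
  ~ left_generic A P a B /\ ~ right_generic A P a B.
Arguments nongeneric : clear implicits.

Lemma not_indepP P a G (b : tup C G) : so_pair A P -> locus_of P a ->
  ~ indep A a (coords b) <-> nongeneric P a (coords b).
Proof.
move=> sP Da; split=> [/contrapT fk|[nl nr]].
  by split=> gen; [apply: (generic_not_forks sP gen)|
    apply: (generic_not_forks (so_reverse sP) gen)].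
by apply; exact: nongeneric_forks (finite_coords b) Da nl nr.
Qed.

Lemma nongeneric_nwo P Q a b : so_pair A P -> so_pair A Q ->
  locus_of P a -> locus_of Q b -> nongeneric P a (coords b) ->
  pairs_not_weakly_orthogonal A P Q.
Proof.
by move=> sP sQ Da Db [nl _] wo; apply/nl/(weakly_orthogonal_generic sP sQ wo).
Qed.

Lemma nongeneric_refl P a : so_pair A P -> locus_of P a ->
  nongeneric P a (coords a).
Proof.
move=> sP Da; split=> g; apply: (lt_irr sP Da).
  by apply: (generic_lt sP g Da) => x; right.
by apply: (generic_lt (so_reverse sP) g Da) => x; right.
Qed.

(** Nongenericity excludes weak orthogonality, so delta holds for one orientation of Q and exchanges
    the generic sides. *)
Lemma nongeneric_sym P Q a b : so_pair A P -> so_pair A Q ->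
  locus_of P a -> locus_of Q b -> nongeneric P a (coords b) ->
  nongeneric Q b (coords a).
Proof.
move=> sP sQ Da Db ng; have [nl nr] := ng.
have [Q' [sQ' eQ [_ d]]] := nwo_delta sP sQ (nongeneric_nwo sP sQ Da Db ng).
by case: eQ d => -> /(_ a b Da Db)[h1 h2]; split=> g;
  [apply/nr/h2|apply/nl/h1|apply/nl/h1|apply/nr/h2].
Qed.

(** If a were left generic over c, interpolation would give b1 with a left generic over b1 and b1
    left generic over c. As b is not left generic over c, b1 is below b, and monotonicity makes a
    left generic over b. *)
Lemma nongeneric_trans_left P Q R a b c :
  so_pair A P -> so_pair A Q -> so_pair A R ->
  delta A P Q -> delta A Q R ->
  locus_of Q b -> locus_of R c ->
  ~ left_generic A P a (coords b) -> nongeneric Q b (coords c) ->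
  ~ left_generic A P a (coords c).
Proof.
move=> sP sQ sR dPQ dQR Db Dc nab [nbc _] gac.
have Da := generic_locus sP gac.
have [_ d] := delta_trans sP sQ sR dPQ dQR.
have gc := (d a c Da Dc).1.1 gac.
have [b1 [gab gbc]] := generic_between sP sQ sR dPQ dQR Da gc.
apply: nab; apply: (delta_mono sP sQ dPQ _ gab).
exact: (generic_lt_nonleft sQ (finite_coords c) gbc Db nbc).
Qed.

(** After orienting Q and R along P, the right half is the left half for the reversed pairs. *)
Lemma nongeneric_trans P Q R a b c :
  so_pair A P -> so_pair A Q -> so_pair A R ->
  locus_of P a -> locus_of Q b -> locus_of R c ->
  nongeneric P a (coords b) -> nongeneric Q b (coords c) ->
  nongeneric P a (coords c).
Proof.
move=> sP sQ sR Da Db Dc nab nbc.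
have nPQ := nongeneric_nwo sP sQ Da Db nab.
have nQR := nongeneric_nwo sQ sR Db Dc nbc.
have [Q' [sQ' eQ dPQ]] := nwo_delta sP sQ nPQ.
have nQR' : pairs_not_weakly_orthogonal A Q' R by case: eQ => ->.
have [R' [sR' eR dQR]] := nwo_delta sQ' sR nQR'.
have [nl nr] := nab; have [ml mr] := nbc.
case: eQ eR dPQ dQR sQ' sR' => -> [] -> dPQ dQR sQ' sR'; split.
all: first [apply: (nongeneric_trans_left sP sQ' sR' dPQ dQR Db Dc) => //; by split
  | apply: (nongeneric_trans_left (so_reverse sP) (so_reverse sQ') (so_reverse sR')
     (delta_reverse dPQ) (delta_reverse dQR) Db Dc) => //; by split].
Qed.

Lemma nongeneric_aut P g h a G (b : tup C G) : so_pair A P -> aut A g h ->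
  nongeneric P a (coords b) -> nongeneric P (app g a) (coords (app g b)).
Proof.
move=> sP gA [nl nr]; have hA := aut_inv gA; split=> gen.
  by apply: nl; have := generic_aut sP hA gen; rewrite !(appK _ gA).
by apply: nr; have := generic_aut (so_reverse sP) hA gen; rewrite !(appK _ gA).
Qed.

Lemma not_fork_orthogonalP P Q : so_pair A P ->
  not_fork_orthogonal A (ftype_of P) (ftype_of Q) <->
  exists a b, [/\ locus_of P a, locus_of Q b & nongeneric P a (coords b)].
Proof.
move=> sP; split=> [nf|[a [b [Da Db ng]]] fo].
  apply: contrapT => no; apply: nf => a b Da Db; apply: contrapT => ni.
  by apply: no; exists a, b; split=> //; exact/(not_indepP b sP Da).
by have /(not_indepP b sP Da) := ng; apply; exact: fo.
Qed.

(** * The equivalence relations and the splitting of classes *)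

Lemma nwo_equivalence_types :
  equivalence_on (so_types A) (not_weakly_orthogonal A).
Proof.
split.
- by move=> _ [P sP <-]; exact: nwo_refl.
- by move=> _ _ [P sP <-] [Q sQ <-]; exact: nwo_sym.
- by move=> _ _ _ [P sP <-] [Q sQ <-] [R sR <-]; exact: nwo_trans.
Qed.

Lemma nwo_equivalence_pairs :
  equivalence_on (so_pairs A) (pairs_not_weakly_orthogonal A).
Proof.
by split; [exact: nwo_refl|move=> P Q _ _; exact: nwo_sym|exact: nwo_trans].
Qed.

Lemma delta_equivalence : equivalence_on (so_pairs A) (delta A).
Proof.
by split; [exact: delta_refl|move=> P Q _ _; exact: delta_sym|exact: delta_trans].
Qed.

Lemma reverse_delta_class P : so_pair A P ->
  @reverse L C @` class_of (so_pairs A) (delta A) P =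
  class_of (so_pairs A) (delta A) (reverse P).
Proof.
move=> sP; apply/seteqP; split=> [_ [Q [sQ d] <-]|Q [sQ d]].
  by split; [exact: so_reverse|exact: delta_reverse].
exists (reverse Q); last exact: reverseK.
split; first exact: so_reverse.
by have := delta_reverse d; rewrite reverseK.
Qed.

Lemma nwo_class_split P : so_pair A P ->
  class_of (so_pairs A) (pairs_not_weakly_orthogonal A) P =
  class_of (so_pairs A) (delta A) P `|`
  class_of (so_pairs A) (delta A) (reverse P).
Proof.
move=> sP; apply/seteqP; split=> [Q [sQ nw]|Q [[sQ [nw _]]|[sQ [nw _]]]] //.
have [d|d] := delta_or sP sQ nw; [by left|right; split=> //].
by have := delta_reverse d; rewrite reverseK.
Qed.

Lemma delta_class_disjoint P : so_pair A P ->
  class_of (so_pairs A) (delta A) P `&`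
  class_of (so_pairs A) (delta A) (reverse P) = set0.
Proof.
move=> sP; apply/seteqP; split=> // Q [[sQ d1] [_ d2]].
apply: (delta_not_both sP sQ d1).
by have := delta_reverse d2; rewrite reverseK.
Qed.

Lemma forks_equivalence : equivalence_on (so_realizations A) (forks_with A).
Proof.
split.
- move=> _ [_ [P sP <-] [a Da ->]].
  by apply/(not_indepP a sP Da); exact: nongeneric_refl.
- move=> _ _ [_ [P sP <-] [a Da ->]] [_ [Q sQ <-] [b Db ->]].
  move=> /(not_indepP b sP Da) ng; apply/(not_indepP a sQ Db).
  exact: (nongeneric_sym sP sQ Da Db ng).
- move=> _ _ _ [_ [P sP <-] [a Da ->]] [_ [Q sQ <-] [b Db ->]]
    [_ [R sR <-] [c Dc ->]].
  move=> /(not_indepP b sP Da) n1 /(not_indepP c sQ Db) n2.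
  apply/(not_indepP c sP Da); exact: (nongeneric_trans sP sQ sR Da Db Dc n1 n2).
Qed.

Lemma fork_orthogonal_equivalence :
  equivalence_on (so_types A) (not_fork_orthogonal A).
Proof.
split.
- move=> _ [P sP <-]; have [a Da] := locus_nonempty sP.
  apply/(not_fork_orthogonalP P sP); exists a, a.
  by split=> //; exact: nongeneric_refl.
- move=> _ _ [P sP <-] [Q sQ <-] /(not_fork_orthogonalP Q sP)[a [b [Da Db ng]]].
  apply/(not_fork_orthogonalP P sQ); exists b, a.
  by split=> //; exact: (nongeneric_sym sP sQ Da Db ng).
- move=> _ _ _ [P sP <-] [Q sQ <-] [R sR <-].
  move=> /(not_fork_orthogonalP Q sP)[a [b [Da Db n1]]].
  move=> /(not_fork_orthogonalP R sQ)[b' [c [Db' Dc n2]]].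
  (* The two hypotheses come with different realizations of Q; an automorphism over [A] makes them
     agree and carries c along. *)
  have [g [h [gA gb]]] := locus_conjugate sQ Db' Db.
  apply/(not_fork_orthogonalP R sP); exists a, (app g c).
  have Dgc := (locus_aut sR c gA).2 Dc.
  split=> //; apply: (nongeneric_trans sP sQ sR Da Db Dgc n1).
  by rewrite -gb; exact: (nongeneric_aut sQ gA n2).
Qed.
End SoPairs.

Theorem theorem5p9 (L : language) (T : set (sentence L))
    (hT : complete_theory T) (kappa : Type) (C : structure L)
    (hC : monster kappa T C) (A : set (elt C)) (hA : small kappa A) :
  (equivalence_on (so_types A) (not_weakly_orthogonal A) /\
   equivalence_on (so_pairs A) (pairs_not_weakly_orthogonal A)) /\
  (equivalence_on (so_pairs A) (delta A) /\
   (forall P Q, so_pairs A P -> so_pairs A Q ->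
      delta A P Q -> pairs_not_weakly_orthogonal A P Q) /\
   (forall K, classes (so_pairs A) (pairs_not_weakly_orthogonal A) K ->
      exists K1 K2,
        [/\ classes (so_pairs A) (delta A) K1,
            classes (so_pairs A) (delta A) K2,
            K = K1 `|` K2,
            K1 `&` K2 = set0
          & @reverse L C @` K1 = K2 /\ @reverse L C @` K2 = K1])) /\
  equivalence_on (so_realizations A) (forks_with A) /\
  equivalence_on (so_types A) (not_fork_orthogonal A).
Proof.
case: hC => -[sn _] _ sC hom.
split; first split.
- exact: nwo_equivalence_types sn sC hom hA.
- exact: nwo_equivalence_pairs sn sC hom hA.
split; last first.
  split; first exact: forks_equivalence sn sC hom hA.
  exact: fork_orthogonal_equivalence sn sC hom hA.
split; first exact: delta_equivalence sn sC hom hA.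
split=> [P Q _ _ []//|_ [P sP <-]].
have sP' := so_reverse sP.
exists (class_of (so_pairs A) (delta A) P),
  (class_of (so_pairs A) (delta A) (reverse P)); split.
- by exists P.
- by exists (reverse P).
- exact: nwo_class_split sn sC hom hA P sP.
- exact: delta_class_disjoint sn sC hom hA P sP.
- by rewrite !reverse_delta_class // reverseK.
Qed.
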